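(* Let $H:\mathbb{R}^N\to[0,+\infty)$ be an admissible anisotropy (as defined in the context) and let $1<p<N$. Let $F:\Omega\times(0,+\infty)\to[0,+\infty)$ be a Carathéodory function such that, for a.e. $x\in\Omega$, the map $$s\mapsto \frac{F(x,s)}{s^{p-1}}$$ is strictly decreasing on $(0,+\infty)$. Then there exists at most one weak solution $u\in W^{1,p}_0(\Omega)$ to $$\begin{cases}-\Delta_p^H u=F(x,u)&\text{in }\Omega,\\ u=0&\text{on }\partial\Omega.\end{cases}$$
   Context: $\Omega\subset\mathbb{R}^N$ ($N\ge2$) is an open bounded set with smooth boundary. Admissible anisotropy: a function $H:\mathbb{R}^N\to[0,+\infty)$ such that (1) $H\in C^2_{\rm loc}(\mathbb{R}^N\setminus\{0\})$, $H$ is even and $H(\xi)>0$ for all $\xi\ne0$; (2) $H(t\xi)=tH(\xi)$ for all $\xi\in\mathbb{R}^N\setminus\{0\}$ and $t>0$ (and $H(0)=0$); (3) there exists $\lambda>0$ such that $D^2H(\xi)\zeta\cdot\zeta\ge\lambda|\zeta|^2$ for all $\xi$ with $H(\xi)=1$ and all $\zeta\in\nabla H(\xi)^\perp$. The anisotropic Finsler $p$-Laplacian is $\Delta_p^Hu:=\operatorname{div}\left(H^{p-1}(\nabla u)\nabla H(\nabla u)\right)$, where the vector field $\xi\mapsto H^{p-1}(\xi)\nabla H(\xi)$ is understood to be $0$ at $\xi=0$. Carathéodory: $s\mapsto F(x,s)$ is continuous for a.e. $x\in\Omega$, and $x\mapsto F(x,s)$ is measurable for every fixed $s$. Weak solution: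 a positive (a.e. in $\Omega$) function $u\in W^{1,p}_0(\Omega)$ such that $F(x,u)\in L^1_{\rm loc}(\Omega)$ and $$\int_\Omega H^{p-1}(\nabla u)\nabla H(\nabla u)\cdot\nabla\varphi\,dx=\int_\Omega F(x,u)\varphi\,dx\qquad\forall\varphi\in C^1_c(\Omega).$$ *)

(* Defs.v *)
From HB Require Import structures.
From mathcomp Require Import all_boot all_order all_algebra.
From mathcomp Require Import all_classical all_reals all_analysis.

Set Implicit Arguments.
Unset Strict Implicit.
Unset Printing Implicit Defensive.

Import Order.TTheory GRing.Theory Num.Theory.
Import numFieldNormedType.Exports.

Local Open Scope classical_set_scope.
Local Open Scope ring_scope.

Section lebesgue_outer.
Context {R : realType} {N : nat}.
Implicit Types a b : 'rV[R]_N.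

Definition box a b : set 'rV[R]_N :=
  [set x | forall i, a 0 i < x 0 i <= b 0 i].

Definition box_volume a b : R := \prod_i Num.max 0 (b 0 i - a 0 i).

(* The index set [D] makes covers finite or countable: without it, the empty
   set would have outer measure 1 in dimension 0. *)
Definition box_cover (A : set 'rV[R]_N)
    (c : set nat * (nat -> 'rV[R]_N * 'rV[R]_N)) : Prop :=
  A `<=` \bigcup_(k in c.1) box (c.2 k).1 (c.2 k).2.

Definition cover_volume (c : set nat * (nat -> 'rV[R]_N * 'rV[R]_N)) : \bar R :=
  (\esum_(k in c.1) (box_volume (c.2 k).1 (c.2 k).2)%:E)%E.

Definition lebesgue_outer (A : set 'rV[R]_N) : \bar R :=
  ereal_inf [set cover_volume c | c in box_cover A].

Local Open Scope ereal_scope.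

Lemma box_volume_ge0 a b : 0 <= (box_volume a b)%:E.
Proof. by rewrite lee_fin prodr_ge0// => i _; rewrite le_max lexx. Qed.

Lemma lebesgue_outer_ge0 A : 0 <= lebesgue_outer A.
Proof.
apply: le_ereal_inf_tmp => _ [c _ <-].
by apply: esum_ge0 => k _; exact: box_volume_ge0.
Qed.

Lemma lebesgue_outer0 : lebesgue_outer set0 = 0.
Proof.
apply/eqP; rewrite eq_le lebesgue_outer_ge0 andbT.
apply: ereal_inf_lbound; exists (set0, fun=> (0%R, 0%R)) => //.
by rewrite /cover_volume/= esum_set0.
Qed.

Lemma le_lebesgue_outer :
  {homo lebesgue_outer : A B / A `<=` B >-> A <= B}.
Proof.
move=> A B AB; apply/ereal_inf_le_tmp => _ [c Bc <-].
by exists c => //; exact: subset_trans AB Bc.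
Qed.

Lemma lebesgue_outer_sigma_subadditive : sigma_subadditive lebesgue_outer.
Proof.
move=> A; have [[i ioo]|] := pselect (exists i, lebesgue_outer (A i) = +oo).
  rewrite (eseries_pinfty _ _ ioo) ?leey// => n _.
  by rewrite -ltNye (lt_le_trans _ (lebesgue_outer_ge0 _)).
rewrite -forallNE => Aoo.
suff add2e (e : {posnum R}) : lebesgue_outer (\bigcup_n A n) <=
    \sum_(i <oo) lebesgue_outer (A i) + e%:num%:E.
  by apply/lee_addgt0Pr => _/posnumP[].
rewrite (le_trans _ (epsilon_trick _ _ _))//; last first.
  by move=> n; exact: lebesgue_outer_ge0.
pose P n c := box_cover (A n) c /\
  cover_volume c <= lebesgue_outer (A n) + (e%:num / (2 ^ n.+1)%:R)%:E.
have [G PG] : {G : nat -> _ & forall n, P n (G n)}.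
  apply: (@choice _ _ P) => n; rewrite /P.
  have en1 : (0 < e%:num / (2 ^ n.+1)%:R :> R)%R by [].
  have fA : lebesgue_outer (A n) \is a fin_num.
    by rewrite ge0_fin_numE ?lebesgue_outer_ge0// ltey; apply/eqP; exact: Aoo.
  have [_ [c Ac <-] cA] := lb_ereal_inf_adherent en1 fA.
  by exists c; split => //; exact: ltW.
have /card_esym/ppcard_eqP[f] := card_nat2.
pose D : set nat := [set k | (G (f k).1).1 (f k).2].
pose c : set nat * (nat -> 'rV[R]_N * 'rV[R]_N) :=
  (D, fun k => (G (f k).1).2 (f k).2).
apply: (@le_trans _ _ (cover_volume c)).
  apply: ereal_inf_lbound; exists c => // x [n _ Anx].
  have [j Dj xj] := (PG n).1 x Anx.
  by exists (f^-1%FUN (n, j)); rewrite /c /D /= invK ?inE.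
pose g i j := (box_volume ((G i).2 j).1 ((G i).2 j).2)%:E.
have -> : cover_volume c = \esum_(i in setT) \esum_(j in (G i).1) g i j.
  rewrite esum_esum; last by move=> i j _ _; exact: box_volume_ge0.
  rewrite (@reindex_esum _ _ _ D _ f)//; split => [k Dk|k l _ _|[i j] [_ Gij]].
  - by split.
  - by apply: inj; rewrite inE.
  - by exists (f^-1%FUN (i, j)); rewrite /D /= invK ?inE.
rewrite -nneseries_esumT; last first.
  by move=> i; apply: esum_ge0 => j _; exact: box_volume_ge0.
apply: lee_nneseries => i _; last exact: (PG i).2.
by move=> _; apply: esum_ge0 => j _; exact: box_volume_ge0.
Qed.

HB.instance Definition _ := isOuterMeasure.Build R 'rV[R]_N lebesgue_outer
  lebesgue_outer0 lebesgue_outer_ge0 le_lebesgue_outer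
  lebesgue_outer_sigma_subadditive.

End lebesgue_outer.

Definition lebesgue_outer_measure (R : realType) (N : nat) :
  {outer_measure set 'rV[R]_N -> \bar R} := @lebesgue_outer R N.

(* R^N with the sigma-algebra of Lebesgue measurable sets *)
Definition lebesgueRV (R : realType) (N : nat) : measurableType _ :=
  caratheodory_type (lebesgue_outer_measure R N).

Definition lebesgue_rV {R : realType} {N : nat} :
  set (lebesgueRV R N) -> \bar R := lebesgue_outer_measure R N.

HB.instance Definition _ (R : realType) (N : nat) :=
  isMeasure.Build _ (lebesgueRV R N) R (@lebesgue_rV R N)
    (@caratheodory_measure0 _ _ (lebesgue_outer_measure R N))
    (@caratheodory_measure_ge0 _ _ (lebesgue_outer_measure R N))
    (@caratheodory_measure_sigma_additive _ _ (lebesgue_outer_measure R N)).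

Section calculus.
Context {R : realType} {N : nat}.
Implicit Types (A Omega : set 'rV[R]_N) (f : 'rV[R]_N -> R) (x y : 'rV[R]_N).

Definition dot x y : R := \sum_i x 0 i * y 0 i.

Definition partial (i : 'I_N) f : 'rV[R]_N -> R := 'D_(delta_mx 0 i) f.

Definition grad f x : 'rV[R]_N := \row_i partial i f x.

Definition hessian f x : 'M[R]_N := \matrix_(i, j) partial j (partial i f) x.

(* [f] is of class C^k on the open set [A] *)
Fixpoint Ck (k : nat) A f : Prop :=
  (forall x, A x -> {for x, continuous f}) /\
  if k is k'.+1 then
    forall i, (forall x, A x -> derivable f x (delta_mx 0 i)) /\
              Ck k' A (partial i f)
  else True.

Definition Cinfty A f : Prop := forall k, Ck k A f.

Definition csupported Omega f : Prop :=
  compact (closure [set x | f x != 0]) /\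
  closure [set x | f x != 0] `<=` Omega.

Definition Ck_c (k : nat) Omega f : Prop := Ck k setT f /\ csupported Omega f.

Definition Cinfty_c Omega f : Prop := Cinfty setT f /\ csupported Omega f.

End calculus.

(* Near each boundary point, after relabelling and possibly reversing a
   coordinate axis, [Omega] is the strict epigraph of a smooth function of the
   N - 1 other coordinates. *)
Definition smooth_boundary (R : realType) (N : nat) (Omega : set 'rV[R]_N) :=
  forall x0, (closure Omega `\` interior Omega) x0 ->
  exists (r : R) (i : 'I_N) (b : bool) (gamma : 'rV[R]_N.-1 -> R),
    [/\ 0 < r, Cinfty setT gamma &
        forall x, ball x0 r x ->
          Omega x <-> gamma (col' i x) < (-1) ^+ b * x 0 i].

Section sobolev.
Context {R : realType} {N : nat}.
Variables (p : R) (Omega : set 'rV[R]_N).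
Implicit Types (u : 'rV[R]_N -> R) (V : 'rV[R]_N -> 'rV[R]_N).

Definition weak_gradient u V : Prop :=
  forall (i : 'I_N) phi, Cinfty_c Omega phi ->
    (\int[lebesgue_rV]_(x in Omega) (u x * partial i phi x)%:E =
     - \int[lebesgue_rV]_(x in Omega) (V x 0 i * phi x)%:E)%E.

(* membership in L^p(Omega), functions being extended by 0 outside Omega *)
Definition in_Lp u : Prop :=
  (u \_ Omega : lebesgueRV R N -> R) \in Lfun lebesgue_rV p%:E.

Definition Lp_cvg (un : nat -> 'rV[R]_N -> R) u : Prop :=
  (fun n => Lnorm lebesgue_rV p%:E (EFin \o ((un n \- u) \_ Omega)))
    @ \oo --> 0%E.

(* [u] belongs to W^{1,p}(Omega), with weak gradient [V] *)
Definition W1p u V : Prop :=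
  [/\ in_Lp u, forall i, in_Lp (fun x => V x 0 i) & weak_gradient u V].

(* closure of C_c^infty(Omega) in W^{1,p}(Omega) *)
Definition W1p0 u V : Prop :=
  W1p u V /\
  exists phi : nat -> 'rV[R]_N -> R,
    [/\ forall n, Cinfty_c Omega (phi n),
        Lp_cvg phi u &
        forall i, Lp_cvg (fun n => partial i (phi n)) (fun x => V x 0 i)].

Definition L1loc u : Prop :=
  forall K : set 'rV[R]_N, compact K -> K `<=` Omega ->
    lebesgue_rV.-integrable (K : set (lebesgueRV R N)) (EFin \o u).

End sobolev.

Record admissible_anisotropy (R : realType) (N : nat) (H : 'rV[R]_N -> R) :
    Prop := {
  aniso_ge0 : forall xi, 0 <= H xi;
  aniso_C2 : Ck 2 [set xi | xi != 0] H;
  aniso_even : forall xi, H (- xi) = H xi;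
  aniso_gt0 : forall xi, xi != 0 -> 0 < H xi;
  aniso_homogeneous : forall xi t, xi != 0 -> 0 < t -> H (t *: xi) = t * H xi;
  aniso0 : H 0 = 0;
  aniso_elliptic : exists2 lambda : R, 0 < lambda &
    forall xi, H xi = 1 -> forall zeta, dot (grad H xi) zeta = 0 ->
      lambda * dot zeta zeta <= dot (zeta *m hessian H xi) zeta
}.

Section finsler_problem.
Context {R : realType} {N : nat}.
Variables (H : 'rV[R]_N -> R) (p : R) (Omega : set 'rV[R]_N).
Variable F : 'rV[R]_N -> R -> R.

Definition finsler_flux (xi : 'rV[R]_N) : 'rV[R]_N :=
  if xi == 0 then 0 else (H xi `^ (p - 1)) *: grad H xi.

(* Only the values F x s with x in Omega and s > 0 are meaningful. *)
Definition caratheodory_fun : Prop :=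
  {ae lebesgue_rV, forall x : lebesgueRV R N, Omega x ->
    forall s, 0 < s -> {for s, continuous (F x)}} /\
  (forall s, 0 < s ->
    measurable_fun (Omega : set (lebesgueRV R N))
      ((fun x => F x s) : lebesgueRV R N -> R)).

Definition weak_solution (u : 'rV[R]_N -> R) : Prop :=
  exists V : 'rV[R]_N -> 'rV[R]_N,
    [/\ W1p0 p Omega u V,
        {ae lebesgue_rV, forall x : lebesgueRV R N, Omega x -> 0 < u x},
        L1loc Omega (fun x => F x (u x)) &
        forall phi, Ck_c 1 Omega phi ->
          (\int[lebesgue_rV]_(x in Omega)
             (dot (finsler_flux (V x)) (grad phi x))%:E =
           \int[lebesgue_rV]_(x in Omega) (F x (u x) * phi x)%:E)%E].

End finsler_problem.

(* Main.v *)
Require Import Defs.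
From HB Require Import structures.
From mathcomp Require Import all_boot all_order all_algebra.
From mathcomp Require Import all_classical all_reals all_analysis measurable_realfun.
From mathcomp Require Import ring lra.

Set Implicit Arguments.
Unset Strict Implicit.
Unset Printing Implicit Defensive.

Import Order.TTheory GRing.Theory Num.Theory.
Import numFieldNormedType.Exports.

Local Open Scope classical_set_scope.
Local Open Scope ring_scope.

(** Let u and v be weak solutions with weak gradients V and W.  Formally, test
the equation for u with (u^p - v^p)^+ / u^(p-1), the equation for v with
(u^p - v^p)^+ / v^(p-1), and subtract.  By the Picone inequality the difference
of the flux integrals is nonnegative, whereas the difference of the right-hand
sides is the integral over {u > v} of
(F(x,u)/u^(p-1) - F(x,v)/v^(p-1)) (u^p - v^p), whose integrand is negative by
the monotonicity hypothesis.  Hence u <= v almost everywhere, and u = v by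
symmetry.

The Picone inequality reduces to the scalar one of [picone_inequality] because
the flux A satisfies A(X).X = H(X)^p (Euler identity) and
A(X).Y <= H(X)^(p-1) H(Y).  The latter is the convexity of H in the form
grad H(X).Y <= H(Y) ([aniso_grad_le]): ellipticity on the orthogonal of grad H,
together with D^2H(X) X = 0, makes the second derivative of H nonnegative.

The formal test functions must be regularized, since u and v may be unbounded
and v is not bounded away from 0 on compact sets.  With S = e + v, T a smooth
bounded truncation of e + u at level k, and r = T/S, the pair used is
w1 = T eta(r) and w2 = r^(p-1) w1, where eta(r) = ((1 - 1/r)^+)^2.  In the Picone
computation any nonnegative nondecreasing eta is as good as 1 - r^(-p); this one
makes w1 and w2 compositions of u and v with C^1 functions that have bounded
derivatives, at the price of an error supported on {u > k} and controlled by
H(V)^(p-1) H(W).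

The compactly supported smooth functions whose closure defines W^{1,p}_0 are
inserted directly into the test functions: if phi_n -> u and psi_n -> v, then
G(phi_n, psi_n) is a C^1_c test function for every C^1 function G with
G(0,0) = 0.  Along a subsequence the approximants and their
gradients converge almost everywhere under an L^p majorant
([W1p0_approximated]), so every flux term passes to the limit by dominated
convergence ([cvg_flux]).  On the right-hand side F(x,u) is integrable on compact
sets only.  For G >= 0 the Fatou lemma gives one inequality ([fatou_test]), which
is what the test w2 needs.  The opposite inequality, needed for w1, is obtained
by multiplying with a cutoff of a fixed approximant, whose support is compact, and
then removing the cutoff ([upper_test]).

Finally e -> 0 and k -> +oo.  Since w1 <= u and F(x,u) u is integrable
([energy_bound]), the Fatou lemma applies to F(x,u) u - F(x,u) w1 + F(x,v) w2 and
shows that the integral of the limit of F(x,v) w2 - F(x,u) w1 is nonpositive.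
This limit is nonnegative, and positive where u > v ([comparison]). *)


(** * Directional derivatives of real functions *)
Section derivation_rules.
Context {R : realType} {V : normedModType R}.
Implicit Types (f g : V -> R) (x v : V).

Lemma is_derive_add f g x v (df dg : R) : is_derive x v f df -> is_derive x v g dg ->
  is_derive x v (fun z => f z + g z) (df + dg).
Proof. by move=> ? ?; exact: is_deriveD. Qed.

Lemma is_derive_sub f g x v (df dg : R) : is_derive x v f df -> is_derive x v g dg ->
  is_derive x v (fun z => f z - g z) (df - dg).
Proof. by move=> ? ?; exact: is_deriveB. Qed.

Lemma is_derive_mul f g x v (df dg : R) : is_derive x v f df -> is_derive x v g dg ->
  is_derive x v (fun z => f z * g z) (df * g x + f x * dg).
Proof.
move=> fd gd; apply: (is_derive_eq (is_deriveM fd gd)).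
by rewrite /GRing.scale/= addrC; congr (_ + _); rewrite mulrC.
Qed.

Lemma is_derive_const (c : R) x v : is_derive x v (fun=> c) 0.
Proof. exact: is_derive_cst. Qed.

Lemma derive_line f x v :
  'D_1 (fun t : R => f (t *: v + x)) (0 : R) = 'D_v f x.
Proof.
rewrite /derive; set g1 := (fun h => _); set g2 := (fun h => _).
suff -> : g1 = g2 by [].
by apply/funext => h; rewrite /g1 /g2 /= addr0 scale0r add0r [_%:A]mulr1.
Qed.

Lemma is_derive_line f x v (df : R) :
  is_derive x v f df <-> is_derive (0 : R) 1 (fun t : R => f (t *: v + x)) df.
Proof.
split=> -[f1 fE].
  apply: DeriveDef; first exact: (derivable1P f x v).1 f1.
  exact: etrans (derive_line f x v) fE.
apply: DeriveDef; first exact: (derivable1P f x v).2 f1.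
exact: etrans (esym (derive_line f x v)) fE.
Qed.

(** A directional derivative only sees the restriction to a line, so the
one-dimensional chain rule applies in any normed space. *)
Lemma is_derive_comp f (g : R -> R) x v (df dg : R) :
  is_derive x v f df -> is_derive (f x) 1 g dg ->
  is_derive x v (fun z => g (f z)) (dg * df).
Proof.
move=> /is_derive_line fd gd; apply/is_derive_line.
apply: (@is_derive1_comp _ g (fun t : R => f (t *: v + x)) 0 dg df) => //.
by rewrite scale0r add0r.
Qed.

Lemma is_derive_inv f x v (df : R) : is_derive x v f df -> f x != 0 ->
  is_derive x v (fun z => (f z)^-1) (- (f x) ^- 2 * df).
Proof.
move=> fd fx0; apply: (@is_derive_comp f (fun y => y^-1)) => //.
apply: (is_derive_eq (is_deriveV fx0 (is_derive_id (f x) (1 : R)))).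
by rewrite /GRing.scale/= mulr1.
Qed.

End derivation_rules.

Lemma cvg_continuous (R : realType) T (F : set_system T) {FF : Filter F}
    (f : T -> R) (g : R -> R) (l : R) :
  {for l, continuous g} -> f x @[x --> F] --> l -> g (f x) @[x --> F] --> g l.
Proof. by move=> cg fl; exact: cvg_comp fl cg. Qed.

(** * Scalar profiles *)
Section scalar.
Context {R : realType}.
Implicit Types (f g : R -> R).

(** A profile whose slope vanishes at c can be frozen on the left of c without
losing differentiability.  The one-sided profiles below are all made C^1 in this
way. *)
Lemma is_derive_max f f' (c : R) : (forall y, c <= y -> is_derive y 1 f (f' y)) ->
  f' c = 0 ->
  forall x : R, is_derive x 1 (fun z => f (Num.max z c)) (f' (Num.max x c)).
Proof.
move=> df f'c x; have [xc|cx|->] := ltgtP x c.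
- rewrite f'c.
  apply: (near_eq_is_derive (f := cst (f c))).
  by near=> z; rewrite /cst /= max_r//; apply: ltW; near: z; exact: lt_nbhsl.
- apply: (near_eq_is_derive (f := f)); last by apply: df; exact: ltW.
  by near=> z; rewrite max_l//; apply: ltW; near: z; exact: lt_nbhsr.
- have /is_derive1_caratheodory[g [gE cg gc]] := df _ (lexx c).
  apply/is_derive1_caratheodory; exists (fun z => g (Num.max z c)).
  have mc : {for c, continuous (fun z : R => Num.max z c)}.
    by apply: continuous_max; [exact: cvg_id|exact: cvg_cst].
  split=> [z| |]; last by rewrite maxxx gc.
  + rewrite maxxx gE; case: (leP z c) => zc //.
    by rewrite gc f'c !mul0r.
  + by apply: continuous_comp mc _; rewrite maxxx.
Unshelve. all: by end_near. Qed.

(** A convex C^1 substitute for the positive part.  It vanishes for s <= 0, its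
slope is at most 1, and s - smooth_pos s stays below 1, so that s - smooth_pos s
is a concave truncation of s that is exact on the negative axis. *)
Definition smooth_pos (s : R) : R := let r := Num.max s 0 in r ^+ 2 / (1 + r).
Definition dsmooth_pos (s : R) : R :=
  let r := Num.max s 0 in (r ^+ 2 + 2 * r) / (1 + r) ^+ 2.

Lemma max0_ge0 (s : R) : 0 <= Num.max s 0.
Proof. by rewrite le_max lexx orbT. Qed.

Lemma is_derive_smooth_pos (s : R) : is_derive s 1 smooth_pos (dsmooth_pos s).
Proof.
apply: (@is_derive_max (fun r => r ^+ 2 / (1 + r))
  (fun r => (r ^+ 2 + 2 * r) / (1 + r) ^+ 2)); last first.
  by rewrite expr0n/= mulr0 add0r mul0r.
move=> y y0; have y1 : 1 + y != 0 by apply/lt0r_neq0; lra.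
have d1 : is_derive y 1 (fun r : R => 1 + r) 1.
  apply: (is_derive_eq (is_derive_add (is_derive_const 1 y 1) (is_derive_id y 1))).
  by rewrite add0r.
have d2 : is_derive y 1 (fun r : R => (1 + r)^-1) (- (1 + y) ^- 2).
  by apply: (is_derive_eq (is_derive_inv d1 y1)); rewrite mulr1.
have d0 := is_derive_mul (is_derive_id y (1 : R)) (is_derive_id y (1 : R)).
by apply: (is_derive_eq (is_derive_mul d0 d2)); field.
Qed.

Lemma smooth_pos_ge0 s : 0 <= smooth_pos s.
Proof.
by rewrite /smooth_pos/= divr_ge0 ?exprn_ge0 ?addr_ge0 ?max0_ge0.
Qed.

Lemma smooth_pos_le0 s : s <= 0 -> smooth_pos s = 0.
Proof. by move=> s0; rewrite /smooth_pos/= max_r// expr0n mul0r. Qed.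

Lemma smooth_pos_ge s : s - 1 <= smooth_pos s.
Proof.
have [s0|s0] := leP s 0; first by rewrite smooth_pos_le0//; lra.
have ? : 0 < 1 + s by lra.
have -> : smooth_pos s = s ^+ 2 / (1 + s) by rewrite /smooth_pos/= max_l// ltW.
by rewrite ler_pdivlMr//; nra.
Qed.

Lemma smooth_pos_le s : smooth_pos s <= Num.max s 0.
Proof.
rewrite /smooth_pos/=; have := max0_ge0 s; set r := Num.max s 0 => r0.
by rewrite ler_pdivrMr; nra.
Qed.

Lemma dsmooth_pos_ge0 s : 0 <= dsmooth_pos s.
Proof.
rewrite /dsmooth_pos/=; have := max0_ge0 s; set r := Num.max s 0 => r0.
by rewrite divr_ge0//; nra.
Qed.

Lemma dsmooth_pos_le0 s : s <= 0 -> dsmooth_pos s = 0.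
Proof. by move=> s0; rewrite /dsmooth_pos/= max_r// expr0n mulr0 addr0 mul0r. Qed.

Lemma dsmooth_pos_le1 s : dsmooth_pos s <= 1.
Proof.
rewrite /dsmooth_pos/=; have := max0_ge0 s; set r := Num.max s 0 => r0.
by rewrite ler_pdivrMr; nra.
Qed.

Lemma continuous_max0 (c : R) : continuous (fun s : R => Num.max s c).
Proof. by move=> s; apply: continuous_max; [exact: cvg_id|exact: cvg_cst]. Qed.

Lemma is_derive_continuous (f f' : R -> R) :
  (forall s : R, is_derive s 1 f (f' s)) -> continuous f.
Proof.
move=> df s; apply/differentiable_continuous/derivable1_diffP.
by have [] := df s.
Qed.

Lemma continuous_smooth_pos : continuous smooth_pos.
Proof. exact: is_derive_continuous is_derive_smooth_pos. Qed.

Lemma continuous_dsmooth_pos : continuous dsmooth_pos.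
Proof.
move=> s; rewrite /dsmooth_pos; have r0 := max0_ge0 s.
have cm := @continuous_max0 0 s.
apply: cvgM.
  by apply: cvgD; [exact: (cvgM cm cm)|apply: cvgM => //; exact: cvg_cst].
apply: cvgV; first by rewrite expf_eq0/=; apply/lt0r_neq0; lra.
have c1 : (1 + Num.max z 0) @[z --> s] --> 1 + Num.max s 0.
  by apply: cvgD => //; exact: cvg_cst.
exact: (cvgM c1 c1).
Qed.

(** The factor r^a ((1 - 1/r)^+)^2 of the Picone test functions, in the variable
r = u / v; the square makes it C^1 at r = 1. *)
Definition weight (a r : R) : R :=
  let m := Num.max r 1 in m `^ a * (1 - m^-1) ^+ 2.
Definition dweight (a r : R) : R :=
  let m := Num.max r 1 in
  m `^ (a - 1) * (a * (1 - m^-1) ^+ 2 + 2 * (1 - m^-1) * m^-1).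

Lemma is_derive_weight (a s : R) : is_derive s 1 (weight a) (dweight a s).
Proof.
apply: (@is_derive_max (fun m => m `^ a * (1 - m^-1) ^+ 2)
  (fun m => m `^ (a - 1) * (a * (1 - m^-1) ^+ 2 + 2 * (1 - m^-1) * m^-1)));
  last by rewrite invr1 subrr; ring.
move=> y y1; have y0 : 0 < y by lra.
have yn0 : y != 0 by apply/lt0r_neq0; lra.
have d2 : is_derive y 1 (fun r : R => r^-1) (- y ^- 2).
  by apply: (is_derive_eq (is_derive_inv (is_derive_id y 1) yn0)); rewrite mulr1.
have d3 := is_derive_sub (is_derive_const 1 y 1) d2.
apply: (is_derive_eq (is_derive_mul (is_derive1_powR a y0) (is_derive_mul d3 d3))).
have -> : y `^ a = y `^ (a - 1) * y.
  by rewrite -{3}(powRr1 (ltW y0)) -powRD ?subrK// yn0 implybT.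
by field.
Qed.

Lemma weight_ge0 a r : 0 <= weight a r.
Proof. by rewrite /weight/= mulr_ge0 ?powR_ge0 ?sqr_ge0. Qed.

Lemma weight_le1 a r : r <= 1 -> weight a r = 0.
Proof. by move=> r1; rewrite /weight/= max_r// invr1 subrr expr0n mulr0. Qed.

Lemma dweight_le1 a r : r <= 1 -> dweight a r = 0.
Proof. by move=> r1; rewrite /dweight/= max_r// invr1 subrr; ring. Qed.

Lemma max1_ge1 (r : R) : 1 <= Num.max r 1.
Proof. by rewrite le_max lexx orbT. Qed.

Lemma continuous_weight a : continuous (weight a).
Proof. exact: is_derive_continuous (is_derive_weight a). Qed.

Lemma continuous_powR_pos (a y : R) : 0 < y ->
  {for y, continuous (fun x : R => x `^ a)}.
Proof.
move=> y0; apply/differentiable_continuous/derivable1_diffP.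
by have [] := is_derive1_powR a y0.
Qed.

Lemma continuous_dweight a : continuous (dweight a).
Proof.
move=> s; rewrite /dweight; have r1 := max1_ge1 s.
have cm := @continuous_max0 1 s.
have cV : (Num.max z 1)^-1 @[z --> s] --> (Num.max s 1)^-1.
  by apply: cvgV => //; apply/lt0r_neq0; lra.
have c1 : (1 - (Num.max z 1)^-1) @[z --> s] --> 1 - (Num.max s 1)^-1.
  by apply: cvgB => //; exact: cvg_cst.
apply: cvgM.
  apply: (@cvg_continuous _ _ _ _ (fun z => Num.max z 1) (fun x => x `^ (a - 1))) => //.
  by apply: continuous_powR_pos; lra.
apply: cvgD.
  by apply: cvgM; [exact: cvg_cst|exact: (cvgM c1 c1)].
by apply: cvgM => //; apply: cvgM => //; exact: cvg_cst.
Qed.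

End scalar.

(** * Truncations and the Picone inequality *)
Section picone.
Context {R : realType}.

(** The power function lies above its tangent at z; this is the Young inequality
for the exponents p and p / (p - 1). *)
Lemma powR_tangent (x z p : R) : 0 <= x -> 0 <= z -> 1 < p ->
  p * (z `^ (p - 1) * x) <= x `^ (p - 1) * x + (p - 1) * (z `^ (p - 1) * z).
Proof.
move=> x0 z0 p1.
have p0 : 0 < p by lra.
have pn0 : p != 0 by apply/lt0r_neq0.
have q0 : 0 < p - 1 by lra.
have qn0 : p - 1 != 0 by apply/lt0r_neq0.
have := @conjugate_powR _ x (z `^ (p - 1)) p (p / (p - 1)) x0 (powR_ge0 _ _) p0.
rewrite divr_gt0// => /(_ isT); rewrite -powRrM.
have -> : p^-1 + (p / (p - 1))^-1 = 1 by field; rewrite pn0 qn0.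
have -> : (p - 1) * (p / (p - 1)) = p by field.
rewrite -!(mulr_powRB1 _ p0)// => /(_ erefl).
set A := x `^ _; set B := z `^ _; rewrite -(ler_pM2l p0).
have -> : p * (x * A / p + z * B / (p / (p - 1))) = x * A + (p - 1) * (z * B).
  by field; rewrite pn0 qn0.
by nra.
Qed.

Lemma powR_monotone (x z a : R) : 0 <= x -> 0 <= z -> 0 <= a ->
  0 <= (x `^ a - z `^ a) * (x - z).
Proof.
move=> x0 z0 a0; have [xz|/ltW zx] := leP x z.
  by rewrite mulr_le0// subr_le0// ge0_ler_powR.
by rewrite mulr_ge0// subr_ge0// ge0_ler_powR.
Qed.

End picone.

Section truncations.
Context {R : realType}.
Implicit Types e k s t : R.

(** e + s below the level k, flattened above it. *)
Definition trunc e k s := e + s - smooth_pos (s - k).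
Definition dtrunc k s := 1 - dsmooth_pos (s - k).
(** e + t on the positive axis.  For t < 0 the correction keeps the value above
e / 2: approximants of a positive function may be negative, and quotients by
lift_pos must remain harmless there. *)
Definition lift_pos e t := e + t + e / 2 * smooth_pos (- (2 / e) * t).
Definition dlift_pos e t := 1 - dsmooth_pos (- (2 / e) * t).

Lemma is_derive_trunc e k s : is_derive s 1 (trunc e k) (dtrunc k s).
Proof.
have d1 := is_derive_sub (is_derive_id s 1) (is_derive_const k s 1).
have d0 := is_derive_add (is_derive_const e s 1) (is_derive_id s 1).
have d2 := is_derive_sub d0 (is_derive_comp d1 (is_derive_smooth_pos _)).
by apply: (is_derive_eq d2); rewrite /dtrunc; ring.
Qed.

Lemma is_derive_lift_pos e t : 0 < e -> is_derive t 1 (lift_pos e) (dlift_pos e t).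
Proof.
move=> e0; have en0 : e != 0 by apply/lt0r_neq0.
have d1 := is_derive_mul (is_derive_const (- (2 / e)) t 1) (is_derive_id t 1).
have d2 := is_derive_mul (is_derive_const (e / 2) t 1) (is_derive_comp d1 (is_derive_smooth_pos _)).
have d3 := is_derive_add (is_derive_add (is_derive_const e t 1) (is_derive_id t 1)) d2.
by apply: (is_derive_eq d3); rewrite /dlift_pos; field.
Qed.

Lemma continuous_trunc e k : continuous (trunc e k).
Proof. exact: is_derive_continuous (is_derive_trunc e k). Qed.

Lemma continuous_lift_pos e : 0 < e -> continuous (lift_pos e).
Proof.
by move=> e0; exact: (is_derive_continuous (fun t => is_derive_lift_pos t e0)).
Qed.

Lemma continuous_dtrunc k : continuous (dtrunc k).
Proof.
move=> s; apply: cvgB; first exact: cvg_cst.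
apply: (@cvg_continuous _ _ _ _ (fun s => s - k) (@dsmooth_pos R)).
  exact: continuous_dsmooth_pos.
by apply: cvgB; [exact: cvg_id|exact: cvg_cst].
Qed.

Lemma continuous_dlift_pos e : continuous (dlift_pos e).
Proof.
move=> s; apply: cvgB; first exact: cvg_cst.
apply: (@cvg_continuous _ _ _ _ (fun s => - (2 / e) * s) (@dsmooth_pos R)).
  exact: continuous_dsmooth_pos.
by apply: cvgM; [exact: cvg_cst|exact: cvg_id].
Qed.

Lemma trunc_le e k s : trunc e k s <= e + k + 1.
Proof. by have := smooth_pos_ge (s - k); rewrite /trunc; lra. Qed.

Lemma lift_pos_ge e t : 0 < e -> e / 2 <= lift_pos e t.
Proof.
move=> e0; have := smooth_pos_ge (- (2 / e) * t).
have e2 : 0 < e / 2 by lra.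
rewrite -(ler_pM2l e2).
have -> : e / 2 * (- (2 / e) * t - 1) = - t - e / 2.
  by field; apply/lt0r_neq0.
by rewrite /lift_pos; lra.
Qed.

Lemma lift_pos_gt0 e t : 0 < e -> 0 < lift_pos e t.
Proof. by move=> e0; apply: (lt_le_trans _ (lift_pos_ge t e0)); lra. Qed.

Lemma lift_pos_nneg e t : 0 < e -> 0 <= t -> lift_pos e t = e + t.
Proof.
move=> e0 t0; rewrite /lift_pos smooth_pos_le0 ?mulr0 ?addr0//.
by rewrite mulNr oppr_le0 mulr_ge0// divr_ge0// ltW.
Qed.

Lemma dlift_pos_nneg e t : 0 < e -> 0 <= t -> dlift_pos e t = 1.
Proof.
move=> e0 t0; rewrite /dlift_pos dsmooth_pos_le0 ?subr0//.
by rewrite mulNr oppr_le0 mulr_ge0// divr_ge0// ltW.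
Qed.

Lemma dtrunc_itv k s : 0 <= dtrunc k s <= 1.
Proof.
rewrite /dtrunc; have := dsmooth_pos_ge0 (s - k).
by have := dsmooth_pos_le1 (s - k); lra.
Qed.

Lemma dlift_pos_itv e t : 0 <= dlift_pos e t <= 1.
Proof.
rewrite /dlift_pos; have := dsmooth_pos_ge0 (- (2 / e) * t).
have := dsmooth_pos_le1 (- (2 / e) * t).
lra.
Qed.

Lemma trunc_small e k s : s <= k -> trunc e k s = e + s.
Proof. by move=> sk; rewrite /trunc smooth_pos_le0 ?subr0// subr_le0. Qed.

Lemma dtrunc_small k s : s <= k -> dtrunc k s = 1.
Proof. by move=> sk; rewrite /dtrunc dsmooth_pos_le0 ?subr0// subr_le0. Qed.

Lemma trunc_le_id e k s : trunc e k s <= e + s.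
Proof. by rewrite /trunc; have := smooth_pos_ge0 (s - k); lra. Qed.

Lemma trunc_ge e k s : 0 <= k -> 0 <= s -> e <= trunc e k s.
Proof.
move=> k0 s0; rewrite /trunc; have := smooth_pos_le (s - k).
have : Num.max (s - k) 0 <= s by rewrite ge_max s0 andbT; lra.
lra.
Qed.

End truncations.

(** C^1 functions G on the plane with bounded partial derivatives G1 and G2.  The
chain rule is recorded for real functions on a normed space, where it yields the
gradient of G(phi, psi), and the continuity for any filter, since it is used both
at points of R^N and along sequences of approximants. *)
Record C1_bounded (R : realType) (G G1 G2 : R -> R -> R) : Prop := {
  C1b_chain : forall (V : normedModType R) (f g : V -> R) (x v : V) (df dg : R),
    is_derive x v f df -> is_derive x v g dg ->
    is_derive x v (fun z => G (f z) (g z))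
                  (G1 (f x) (g x) * df + G2 (f x) (g x) * dg);
  C1b_cvg : forall T (F : set_system T) (FF : Filter F) (f g : T -> R) (s t : R),
    f x @[x --> F] --> s -> g x @[x --> F] --> t ->
    [/\ G (f x) (g x) @[x --> F] --> G s t,
        G1 (f x) (g x) @[x --> F] --> G1 s t &
        G2 (f x) (g x) @[x --> F] --> G2 s t];
  C1b_bound : exists C : R, forall s t, `|G1 s t| <= C /\ `|G2 s t| <= C
}.

Section picone_functions.
Context {R : realType}.
Implicit Types a e k r s t x y : R.

Lemma dweight_ge0 a r : 0 <= a -> 0 <= dweight a r.
Proof.
move=> a0; rewrite /dweight/=; have := max1_ge1 r; set m := Num.max r 1 => m1.
have m0 : 0 < m by lra.
have mV : 0 < m^-1 by rewrite invr_gt0.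
have mV1 : m^-1 <= 1 by rewrite invf_le1.
rewrite mulr_ge0 ?powR_ge0// addr_ge0// mulr_ge0 ?sqr_ge0//; last by nra.
by rewrite mulr_ge0//; lra.
Qed.

Lemma mul_dweight a r : 1 <= r ->
  r * dweight a r = r `^ a * (a * (1 - r^-1) ^+ 2 + 2 * (1 - r^-1) * r^-1).
Proof.
move=> r1; have rn0 : r != 0 by apply/lt0r_neq0; lra.
rewrite /dweight max_l// mulrA; congr (_ * _).
have {1}-> : r = r `^ 1 by rewrite powRr1//; lra.
by rewrite -powRD ?subrKC// rn0 implybT.
Qed.

Lemma weight_bound a r B : 0 <= a -> 1 <= B -> r <= B -> weight a r <= B `^ a.
Proof.
move=> a0 B1 rB; rewrite /weight/=; have := max1_ge1 r.
have : Num.max r 1 <= B by rewrite ge_max rB B1.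
set m := Num.max r 1 => mB m1.
have m0 : 0 < m by lra.
have mV : 0 < m^-1 by rewrite invr_gt0.
have mV1 : m^-1 <= 1 by rewrite invf_le1.
have h1 : m `^ a <= B `^ a by rewrite ge0_ler_powR// nnegrE; lra.
have h2 := powR_ge0 m a.
have : (1 - m^-1) ^+ 2 <= 1 by nra.
have : 0 <= (1 - m^-1) ^+ 2 by exact: sqr_ge0.
by nra.
Qed.

Lemma mul_dweight_bound a r B : 0 <= a -> 1 <= B -> r <= B ->
  0 <= r * dweight a r <= B `^ a * (a + 2).
Proof.
move=> a0 B1 rB; have [r1|/ltW r1] := leP r 1.
  by rewrite dweight_le1// mulr0 lexx mulr_ge0 ?powR_ge0//; lra.
rewrite mulr_ge0 ?dweight_ge0//=; last lra.
rewrite mul_dweight//; apply: ler_pM => //; first exact: powR_ge0.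
- have m0 : 0 < r by lra.
  have mV : 0 < r^-1 by rewrite invr_gt0.
  have mV1 : r^-1 <= 1 by rewrite invf_le1.
  rewrite addr_ge0// mulr_ge0 ?sqr_ge0//; last by nra.
  by rewrite mulr_ge0//; lra.
- by rewrite ge0_ler_powR// nnegrE; lra.
- have m0 : 0 < r by lra.
  have mV : 0 < r^-1 by rewrite invr_gt0.
  have mV1 : r^-1 <= 1 by rewrite invf_le1.
  have : (1 - r^-1) ^+ 2 <= 1 by nra.
  by nra.
Qed.

(** The exponents a = 0 and a = p - 1 give the test functions for the equations of
u and v.  Their ratio (T / S)^(p-1), with T = trunc e k s and S = lift_pos e t, is
what brings F(x,u) / u^(p-1) and F(x,v) / v^(p-1) into the comparison. *)
Definition picone_test a e k s t := trunc e k s * weight a (trunc e k s / lift_pos e t).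
Definition picone_test1 a e k s t :=
  let r := trunc e k s / lift_pos e t in dtrunc k s * (weight a r + r * dweight a r).
Definition picone_test2 a e k s t :=
  let r := trunc e k s / lift_pos e t in - (dlift_pos e t * (r * (r * dweight a r))).

Lemma ratio_le e k s t : 0 < e -> 0 <= k ->
  trunc e k s / lift_pos e t <= 2 * (e + k + 1) / e.
Proof.
move=> e0 k0; have S0 := lift_pos_gt0 t e0; have Sg := lift_pos_ge t e0.
rewrite ler_pdivrMr//; apply: (le_trans (trunc_le e k s)).
have -> : 2 * (e + k + 1) / e = (e + k + 1) / (e / 2).
  by field; apply/lt0r_neq0.
rewrite mulrAC ler_pdivlMr; last lra.
by nra.
Qed.

Lemma picone_test_C1_bounded a e k : 0 <= a -> 0 < e -> 0 <= k ->
  C1_bounded (picone_test a e k) (picone_test1 a e k) (picone_test2 a e k).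
Proof.
move=> a0 e0 k0; split.
- move=> V f g x v df dg fd gd.
  have S0 := lift_pos_gt0 (g x) e0.
  have Sn0 : lift_pos e (g x) != 0 by apply/lt0r_neq0.
  have dT := is_derive_comp fd (is_derive_trunc e k (f x)).
  have dS := is_derive_comp gd (is_derive_lift_pos (g x) e0).
  have dr := is_derive_mul dT (is_derive_inv dS Sn0).
  have dk := is_derive_comp dr (is_derive_weight a _).
  apply: (is_derive_eq (is_derive_mul dT dk)).
  by rewrite /picone_test1 /picone_test2 /=; field.
- move=> T F FF f g s t fs gt.
  have cT : trunc e k (f x) @[x --> F] --> trunc e k s.
    by apply: cvg_continuous fs; exact: continuous_trunc.
  have cS : lift_pos e (g x) @[x --> F] --> lift_pos e t.
    by apply: cvg_continuous gt; exact: continuous_lift_pos.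
  have cdT : dtrunc k (f x) @[x --> F] --> dtrunc k s.
    by apply: cvg_continuous fs; exact: continuous_dtrunc.
  have cdS : dlift_pos e (g x) @[x --> F] --> dlift_pos e t.
    by apply: cvg_continuous gt; exact: continuous_dlift_pos.
  have Sn0 : lift_pos e t != 0 by apply/lt0r_neq0/lift_pos_gt0.
  have cr : trunc e k (f x) / lift_pos e (g x) @[x --> F] --> trunc e k s / lift_pos e t.
    by apply: cvgM => //; exact: cvgV.
  have ck : weight a (trunc e k (f x) / lift_pos e (g x)) @[x --> F] -->
      weight a (trunc e k s / lift_pos e t).
    by apply: cvg_continuous cr; exact: continuous_weight.
  have cdk : dweight a (trunc e k (f x) / lift_pos e (g x)) @[x --> F] -->
      dweight a (trunc e k s / lift_pos e t).
    by apply: cvg_continuous cr; exact: continuous_dweight.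
  split.
  + exact: cvgM.
  + by apply: cvgM => //; apply: cvgD => //; exact: cvgM.
  + by apply: cvgN; apply: cvgM => //; apply: cvgM => //; exact: cvgM.
(* B bounds the ratio r from above, and the weights vanish for r <= 1. *)
- set B := 2 * (e + k + 1) / e.
  have B1 : 1 <= B by rewrite /B ler_pdivlMr//; lra.
  exists (B * (B `^ a * (a + 3))) => s t.
  have rB : trunc e k s / lift_pos e t <= B by exact: ratio_le.
  rewrite /picone_test1 /picone_test2 /=; set r := trunc e k s / lift_pos e t in rB *.
  have P0 := powR_ge0 B a.
  have k1 := weight_bound a0 B1 rB; have k2 := weight_ge0 a r.
  have /andP[d1 d2] := mul_dweight_bound a0 B1 rB.
  have /andP[t1 t2] := dtrunc_itv k s; have /andP[s1 s2] := dlift_pos_itv e t.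
  have [rd0 rd1] : 0 <= r * (r * dweight a r) /\ r * (r * dweight a r) <= B * (B `^ a * (a + 2)).
    have [r0|/ltW r0] := leP r 0.
      by rewrite dweight_le1 ?(le_trans r0)// !mulr0; split=> //; nra.
    by split; [exact: mulr_ge0|exact: ler_pM].
  split.
  + rewrite ger0_norm; last by rewrite mulr_ge0// addr_ge0.
    have : weight a r + r * dweight a r <= B `^ a * (a + 3) by lra.
    have : 0 <= B `^ a * (a + 3) by nra.
    by nra.
  + rewrite normrN ger0_norm; last by rewrite mulr_ge0.
    have : B * (B `^ a * (a + 2)) <= B * (B `^ a * (a + 3)) by nra.
    by nra.
Qed.

Lemma picone_test_ge0 a e k s t : 0 < e -> 0 <= picone_test a e k s t.
Proof.
move=> e0; rewrite /picone_test; have [T0|/ltW T0] := leP (trunc e k s) 0.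
  rewrite weight_le1 ?mulr0// (@le_trans _ _ 0)//.
  by rewrite mulr_le0_ge0// invr_ge0 ltW// lift_pos_gt0.
by rewrite mulr_ge0// weight_ge0.
Qed.

Lemma picone_test_bounded a e k : 0 <= a -> 0 < e -> 0 <= k ->
  exists C, forall s t, picone_test a e k s t <= C.
Proof.
move=> a0 e0 k0; exists ((e + k + 1) * (2 * (e + k + 1) / e) `^ a) => s t.
have B1 : 1 <= 2 * (e + k + 1) / e by rewrite ler_pdivlMr//; lra.
have rB := ratio_le s t e0 k0.
have k1 := weight_bound a0 B1 rB.
have Tl := trunc_le e k s.
rewrite /picone_test; have [T0|/ltW T0] := leP (trunc e k s) 0.
  apply: (@le_trans _ _ 0); first by rewrite mulr_le0_ge0// weight_ge0.
  by rewrite mulr_ge0 ?powR_ge0//; lra.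
by apply: ler_pM => //; exact: weight_ge0.
Qed.

Lemma picone_test00 a e k : 0 < e -> 0 <= k -> picone_test a e k 0 0 = 0.
Proof.
move=> e0 k0; rewrite /picone_test trunc_small// lift_pos_nneg// addr0 divff ?lt0r_neq0//.
by rewrite weight_le1// mulr0.
Qed.

(** This bound does not depend on e and k, which makes the test functions for u
admissible in a dominated passage to the limit. *)
Lemma picone_test_le_id e k s t : 0 < e -> 0 <= k -> 0 <= s -> 0 <= t ->
  picone_test 0 e k s t <= s.
Proof.
move=> e0 k0 s0 t0; rewrite /picone_test lift_pos_nneg//; set T := trunc e k s.
have Te : e <= T by exact: trunc_ge.
have Ts : T <= e + s by exact: trunc_le_id.
have S0 : 0 < e + t by lra.
have [r1|r1] := leP (T / (e + t)) 1; first by rewrite weight_le1// mulr0.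
have T0 : 0 < T by lra.
have r0 : 0 < T / (e + t) by rewrite divr_gt0.
rewrite /weight max_l ?(ltW r1)// powRr0 mul1r.
have rV : (T / (e + t))^-1 < 1 by rewrite invf_lt1.
have rV0 : 0 < (T / (e + t))^-1 by rewrite invr_gt0.
apply: (@le_trans _ _ (T * (1 - (T / (e + t))^-1))).
  by move: rV rV0; set q := _^-1 => rV rV0; apply: ler_wpM2l; [exact: ltW|nra].
have -> : T * (1 - (T / (e + t))^-1) = T - (e + t).
  by field; rewrite !lt0r_neq0.
lra.
Qed.

(** The scalars x, y, a11, a12, a21, a22 stand for H(V), H(W) and the products
A(V).V, A(V).W, A(W).V, A(W).W of the flux A.  Put eta = weight 0 r,
th = r dweight 0 r, tau = dtrunc k s and z = r y.  The right-hand side minus the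
left-hand side, without the error term, is at least the sum of
tau eta (x^p + (p-1) z^p - p z^(p-1) x) and
tau th (x^(p-1) - z^(p-1)) (x - z), both nonnegative by convexity, of terms with
nonnegative coefficients times 1 - tau, and of - (1 - tau) th x^(p-1) z.  The last
one is the only negative contribution; since th z = 2 (1 - 1/r) y <= 2 y, the error
term absorbs it. *)
Lemma picone_inequality p e k s t x y a11 a12 a21 a22 :
  1 < p -> 0 < e -> 0 <= k -> 0 <= s -> 0 <= t -> 0 <= x -> 0 <= y ->
  a11 = x `^ (p - 1) * x -> a22 = y `^ (p - 1) * y ->
  a12 <= x `^ (p - 1) * y -> a21 <= y `^ (p - 1) * x ->
  (picone_test1 (p - 1) e k s t * a21 + picone_test2 (p - 1) e k s t * a22) <=
  (picone_test1 0 e k s t * a11 + picone_test2 0 e k s t * a12) +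
  2 * (1 - dtrunc k s) * (x `^ (p - 1) * y).
Proof.
move=> p1 e0 k0 s0 t0 x0 y0 -> -> h12 h21.
rewrite /picone_test1 /picone_test2 /= dlift_pos_nneg// !mul1r.
have := lift_pos_gt0 t e0; set S := lift_pos e t => S0.
have := trunc_ge e k0 s0; set T := trunc e k s => T0.
set r := T / S; have /andP[] := dtrunc_itv k s; set tau := dtrunc k s => tau0 tau1.
have X0 := powR_ge0 x (p - 1); have Y0 := powR_ge0 y (p - 1).
have [r1|/ltW r1] := leP r 1.
  rewrite !weight_le1// !dweight_le1// !mulr0 !addr0 !mulr0 oppr0 !mul0r !addr0 add0r.
  by rewrite mulr_ge0 ?mulr_ge0// subr_ge0.
have r0 : 0 < r by lra.
have kE : weight (p - 1) r = r `^ (p - 1) * weight 0 r.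
  by rewrite /weight max_l// powRr0 mul1r.
have dE : r * dweight (p - 1) r = r `^ (p - 1) * ((p - 1) * weight 0 r + r * dweight 0 r).
  rewrite !mul_dweight// powRr0 mul1r mul0r add0r; congr (_ * (_ + _)).
  by rewrite /weight max_l// powRr0 mul1r.
have rdE : r * (r * dweight 0 r) = 2 * (1 - r^-1).
  rewrite mul_dweight// powRr0 mul1r mul0r add0r; field; exact/lt0r_neq0.
have eta0 := weight_ge0 0 r.
have /andP[th0 _] := mul_dweight_bound (lexx (0:R)) r1 (lexx r).
rewrite kE !dE; move: rdE eta0 th0.
set eta := weight 0 r; set th := r * dweight 0 r => rdE eta0 th0.
pose z := r * y; have z0 : 0 <= z by rewrite mulr_ge0// ltW.
have zE : z `^ (p - 1) = r `^ (p - 1) * y `^ (p - 1) by rewrite powRM// ltW.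
have young := powR_tangent x0 z0 p1.
have mono := @powR_monotone R x z (p - 1) x0 z0 _.
have {mono}mono := mono (ltW (_ : 0 < p - 1)).
have {mono}mono : 0 <= (x `^ (p - 1) - z `^ (p - 1)) * (x - z) by apply: mono; lra.
have Z0 := powR_ge0 z (p - 1).
have P0 := powR_ge0 r (p - 1).
move: mono young Z0 P0 zE X0 Y0 h12 h21.
set X := x `^ _; set Y := y `^ _; set Z := z `^ _; set P := r `^ _.
move=> mono young Z0 P0 zE X0 Y0 h12 h21.
have thz : th * z <= 2 * y.
  rewrite /z mulrA (mulrC th) rdE.
  have : r^-1 > 0 by rewrite invr_gt0.
  by nra.
have b1 : (tau * (P * eta + P * ((p - 1) * eta + th))) * a21 <=
          (tau * (P * eta + P * ((p - 1) * eta + th))) * (Y * x).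
  have q0 : 0 <= (p - 1) * eta + th by rewrite addr_ge0// mulr_ge0//; lra.
  by apply: ler_wpM2l => //; rewrite mulr_ge0// addr_ge0// mulr_ge0.
have b2 : - (r * th) * (X * y) <= - (r * th) * a12.
  by rewrite !mulNr lerN2; apply: ler_wpM2l => //; rewrite mulr_ge0// ltW.
have key : tau * (eta + th) * (X * x) - th * (X * z) + (1 - tau) * (th * z * X)
   + ((p - 1) * eta + th) * (Z * z) - tau * (p * eta + th) * (Z * x) >= 0.
  have -> : tau * (eta + th) * (X * x) - th * (X * z) + (1 - tau) * (th * z * X)
   + ((p - 1) * eta + th) * (Z * z) - tau * (p * eta + th) * (Z * x) =
   tau * eta * (X * x + (p - 1) * (Z * z) - p * (Z * x))
   + (1 - tau) * (p - 1) * eta * (Z * z) + tau * th * ((X - Z) * (x - z))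
   + (1 - tau) * th * (Z * z) by ring.
  have tau' : 0 <= 1 - tau by rewrite subr_ge0.
  have p' : 0 <= p - 1 by lra.
  have ZZ : 0 <= Z * z by exact: mulr_ge0.
  apply: addr_ge0; last by rewrite mulr_ge0// mulr_ge0.
  apply: addr_ge0; last by rewrite mulr_ge0// mulr_ge0.
  apply: addr_ge0; last by rewrite mulr_ge0// mulr_ge0// mulr_ge0.
  by rewrite mulr_ge0 ?subr_ge0// mulr_ge0.
have c1 : P * Y * x = Z * x by rewrite zE.
have c2 : P * Y * r * y = Z * z by rewrite zE /z mulrA.
have c3 : (1 - tau) * (th * z * X) <= (1 - tau) * (2 * y * X).
  by apply: ler_wpM2l; [rewrite subr_ge0|apply: ler_wpM2r].
have e1 : tau * (P * eta + P * ((p - 1) * eta + th)) * (Y * x) =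
   tau * (p * eta + th) * (Z * x) by rewrite -c1; ring.
have e2 : - (r * (P * ((p - 1) * eta + th))) * (Y * y) =
   - (((p - 1) * eta + th) * (Z * z)) by rewrite -c2; ring.
have e3 : - (r * th) * (X * y) = - (th * (X * z)) by rewrite /z; ring.
rewrite e2; move: b1 b2; rewrite e1 e3 => b1 b2.
lra.
Qed.

End picone_functions.

(** * Functions with continuous partial derivatives *)
Section directional.
Context {R : realType} {N : nat}.
Implicit Types (f : 'rV[R]_N -> R) (A : set 'rV[R]_N) (x y v : 'rV[R]_N).

Lemma is_derive_on_line f y v (t d : R) : is_derive (t *: v + y) v f d ->
  is_derive t 1 (fun s : R => f (s *: v + y)) d.
Proof.
move=> /is_derive_line fd; apply/is_derive_line.
suff -> : (fun s : R => f ((s *: (1:R) + t) *: v + y)) =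
          (fun s : R => f (s *: v + (t *: v + y))) by [].
by apply/funext => s; rewrite scalerDl [_%:A]mulr1 addrA.
Qed.

Lemma coordinate_mean_value f x (r e c : R) (i : 'I_N) :
  (forall z, ball x r z -> derivable f z (delta_mx 0 i) /\
     `|partial i f z - c| <= e) ->
  forall y (s : R), ball x r y -> ball x r (s *: delta_mx 0 i + y) ->
  `|f (s *: delta_mx 0 i + y) - f y - s * c| <= e * `|s|.
Proof.
move=> fx.
have pos y (s : R) : 0 <= s -> ball x r y -> ball x r (s *: delta_mx 0 i + y) ->
    `|f (s *: delta_mx 0 i + y) - f y - s * c| <= e * `|s|.
  move=> s0 by_ bs.
  have inb (t : R) : t \in `[0, s] -> ball x r (t *: delta_mx 0 i + y).
    rewrite in_itv/= => /andP[t0 ts]; have [r0 byj] := by_; have [_ bsj] := bs.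
    split => // a j; rewrite !ord1 {a}.
    move: (byj 0 j) (bsj 0 j); rewrite /ball/= !mxE eqxx/=.
    case: (j == i) => /=; last by rewrite !mulr0.
    by rewrite !mulr1 !ltr_norml => /andP[? ?] /andP[? ?]; apply/andP; split; lra.
  have dg (t : R) : t \in `[0, s] -> is_derive t 1 (fun t : R => f (t *: delta_mx 0 i + y))
      (partial i f (t *: delta_mx 0 i + y)).
    move=> ts; apply: is_derive_on_line; apply: DeriveDef => //.
    by have [] := fx _ (inb _ ts).
  pose g (t : R) := f (t *: delta_mx 0 i + y).
  pose dg' (t : R) := partial i f (t *: delta_mx 0 i + y).
  have dgo (u : R) : u \in `]0, s[ -> is_derive u 1 g (dg' u).
    by rewrite in_itv/= => /andP[u0 us]; apply: dg; rewrite in_itv/= !ltW.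
  have cg : {within `[0, s], continuous g}.
    apply: derivable_within_continuous => u us.
    by have [] := dg _ us.
  have [u us gE] := MVT_segment s0 dgo cg.
  have [_] := fx _ (inb _ us).
  have g0 : g 0 = f y by rewrite /g scale0r add0r.
  move: gE; rewrite g0 subr0 /g => ->.
  by rewrite (mulrC s) -mulrBl normrM => h; exact: ler_wpM2r.
move=> y s by_ bs; have [s0|/ltW s0] := leP 0 s; first exact: pos.
have := pos (s *: delta_mx 0 i + y) (- s).
rewrite oppr_ge0 scaleNr addKr => /(_ s0 bs by_).
rewrite normrN (_ : f y - _ - _ = - (f (s *: delta_mx 0 i + y) - f y - s * c)) ?normrN//.
by ring.
Qed.

(** Continuous partial derivatives control all directional derivatives: the
increment along v is split into N increments along the axes, and the mean value
theorem applies to each of them. *)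
Lemma Ck1_is_derive f A x v : open A -> Ck 1 A f -> A x ->
  is_derive x v f (dot (grad f x) v).
Proof.
move=> oA [_ fA] Ax; apply/is_derive_line.
have lim : h^-1 *: (f (h *: v + x) - f x) @[h --> (0 : R)^'] --> dot (grad f x) v.
  apply/cvgrPdist_le => /= e e0.
  (* The error e' on the partial derivatives costs at most e' times the sum below;
     the summand 1 keeps the denominator positive. *)
  pose e' := e / (1 + \sum_i `|v 0 i|).
  have s0 : 0 <= \sum_i `|v 0 i| by rewrite sumr_ge0.
  have e'0 : 0 < e' by rewrite divr_gt0//; lra.
  have : \forall z \near x, A z /\ forall i, `|partial i f z - partial i f x| <= e'.
    have h1 : \forall z \near x, A z by exact: open_nbhs_nbhs.
    suff h2 : \forall z \near x, forall i, `|partial i f z - partial i f x| <= e'.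
      exact: filterI h1 h2.
    apply: (@filter_forall _ _ (fun i z => `|partial i f z - partial i f x| <= e')
      (nbhs x) (nbhs_filter x)) => i; have [_ [ci _]] := fA i.
    have := ci _ Ax => /cvgrPdist_le/(_ _ e'0).
    by apply: filterS => z; rewrite distrC.
  move=> /nbhs_ballP[r /= r0 br].
  near=> h.
  have h0 : h != 0 by near: h; exact: nbhs_dnbhs_neq.
  have hr : `|h| * (1 + \sum_i `|v 0 i|) < r.
    rewrite -ltr_pdivlMr; last lra.
    by near: h; apply: dnbhs0_lt; rewrite divr_gt0//; lra.
  (* w k has made the increment h v in the first k coordinates only. *)
  pose w k : 'rV[R]_N := \row_j (x 0 j + (if (j < k)%N then h * v 0 j else 0)).
  have wb k : ball x r (w k).
    split => // a j; rewrite !ord1 {a} /ball/= mxE opprD addrA subrr sub0r normrN.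
    case: ifP => _; last by rewrite normr0.
    rewrite normrM; apply: le_lt_trans hr; apply: ler_wpM2l => //.
    rewrite (bigD1 j)//=.
    have : 0 <= \sum_(i < N | i != j) `|v 0 i| by rewrite sumr_ge0.
    lra.
  have wS (i : 'I_N) : w i.+1 = (h * v 0 i) *: delta_mx 0 i + w i.
    apply/rowP => j; rewrite !mxE eqxx/= ltnS leq_eqVlt.
    have [->|ji] := eqVneq j i; first by rewrite eqxx ltnn/= mulr1 addr0 addrC.
    have vji : (val j == val i) = false := negbTE ji.
    by rewrite vji /= mulr0 add0r.
  have step (i : 'I_N) : `|f (w i.+1) - f (w i) - (h * v 0 i) * partial i f x|
      <= e' * `|h * v 0 i|.
    rewrite wS; apply: (@coordinate_mean_value _ x r) => //; last by rewrite -wS.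
    by move=> z /br[Az /(_ i) zi]; split => //; have [+ _] := fA i; exact.
  have w0 : w 0%N = x by apply/rowP => j; rewrite mxE ltn0 addr0.
  have wN : w N = h *: v + x by apply/rowP => j; rewrite !mxE ltn_ord addrC.
  have tel : f (h *: v + x) - f x = \sum_(i < N) (f (w i.+1) - f (w i)).
    by rewrite -wN -[in LHS]w0 -(big_mkord xpredT (fun i => f (w i.+1) - f (w i)))
       telescope_sumr.
  have -> : dot (grad f x) v - h^-1 *: (f (h *: v + x) - f x) =
     - (h^-1 * \sum_(i < N) (f (w i.+1) - f (w i) - (h * v 0 i) * partial i f x)).
    rewrite sumrB -tel mulrBr opprB /GRing.scale/= addrC [RHS]addrC; congr (- _ + _).
    rewrite /dot mulr_sumr; apply: eq_bigr => i _.
    by rewrite mxE; field.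
  rewrite normrN normrM normfV ler_pdivrMl ?normr_gt0//.
  apply: (le_trans (ler_norm_sum _ _ _)).
  apply: (le_trans (ler_sum _ (fun i _ => step i))).
  rewrite -mulr_sumr (eq_bigr (fun i => `|h| * `|v 0 i|)); last first.
    by move=> i _; rewrite normrM.
  rewrite -mulr_sumr mulrCA; apply: ler_wpM2l => //.
  rewrite /e' mulrAC ler_pdivrMr; last lra.
  by apply: ler_wpM2l; lra.
have E : (fun h : R => h^-1 *: (((fun t : R => f (t *: v + x)) \o shift 0) (h *: (1 : R))
     - f ((0 : R) *: v + x))) = (fun h : R => h^-1 *: (f (h *: v + x) - f x)).
  by apply/funext => h; rewrite /= addr0 scale0r add0r [_%:A]mulr1.
apply: DeriveDef.
  by rewrite /derivable E; apply/cvg_ex; exists (dot (grad f x) v).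
by rewrite /derive E; exact: cvg_lim lim.
Unshelve. all: by end_near. Qed.

End directional.

(** * Convexity of the anisotropy *)
Section dot_product.
Context {R : realType} {N : nat}.
Implicit Types (x y z : 'rV[R]_N) (a : R).

Lemma dotDr x y z : dot x (y + z) = dot x y + dot x z.
Proof. by rewrite -big_split; apply: eq_bigr => i _; rewrite mxE mulrDr. Qed.

Lemma dotZr x y a : dot x (a *: y) = a * dot x y.
Proof. by rewrite mulr_sumr; apply: eq_bigr => i _; rewrite mxE mulrCA. Qed.

Lemma dotNr x y : dot x (- y) = - dot x y.
Proof. by rewrite -scaleN1r dotZr mulN1r. Qed.

Lemma dotBr x y z : dot x (y - z) = dot x y - dot x z.
Proof. by rewrite dotDr dotNr. Qed.

Lemma dotZl x y a : dot (a *: x) y = a * dot x y.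
Proof. by rewrite mulr_sumr; apply: eq_bigr => i _; rewrite mxE mulrA. Qed.

Lemma dot_ge0 x : 0 <= dot x x.
Proof. by apply: sumr_ge0 => i _; rewrite -expr2 sqr_ge0. Qed.

End dot_product.

Section smooth_off_origin.
Context {R : realType} {N : nat}.
Implicit Types (f g : 'rV[R]_N -> R) (x y v : 'rV[R]_N).

Let E : set 'rV[R]_N := [set x | x != 0].

Lemma open_neq0 : open E.
Proof.
rewrite (_ : E = ~` [set 0]).
  exact/closed_openC/accessible_closed_set1/hausdorff_accessible/norm_hausdorff.
by apply/seteqP; split => x /=; [move/eqP|move=> ?; exact/eqP].
Qed.

Lemma near_line_neq0 x v : x != 0 -> \forall s \near (0 : R), s *: v + x != 0.
Proof.
move=> x0; have cl : {for (0 : R), continuous (fun s : R => s *: v + x)}.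
  apply: cvgD; last exact: cvg_cst.
  by apply: cvgZr_tmp; exact: cvg_id.
have : nbhs ((0 : R) *: v + x) E.
  by rewrite scale0r add0r; exact: (open_nbhs_nbhs (conj open_neq0 x0)).
by move=> /cl.
Qed.

Lemma CkS k (A : set 'rV[R]_N) f : Ck k.+1 A f -> Ck k A f.
Proof.
elim: k f => [f [cf _]|k IH f [cf df]]; first by split.
by split => // i; have [d1 d2] := df i; split => //; exact: IH.
Qed.

(** Homogeneity of the derivatives of H, the Euler identity and their
consequences all come from reading a directional derivative off an explicit
formula for the function along a line. *)
Lemma grad_unique f (h : R -> R) x v (d : R) : Ck 1 E f -> x != 0 ->
  (\forall s \near (0 : R), f (s *: v + x) = h s) -> is_derive (0 : R) 1 h d ->
  dot (grad f x) v = d.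
Proof.
move=> Cf x0 fh dh.
have /is_derive_line[_ <-] := Ck1_is_derive v open_neq0 Cf x0.
have [_ <-] := dh; exact: near_eq_derive.
Qed.

Lemma homogeneous_grad f (t c : R) x v : 0 < t -> x != 0 -> Ck 1 E f ->
  (forall y, y != 0 -> f (t *: y) = c * f y) ->
  t * dot (grad f (t *: x)) v = c * dot (grad f x) v.
Proof.
move=> t0 x0 Cf fh.
have tx0 : t *: x != 0 by rewrite scaler_eq0 negb_or x0 lt0r_neq0.
rewrite -dotZr; apply: (grad_unique Cf tx0 (h := fun s => c * f (s *: v + x))).
  have := near_line_neq0 v x0; apply: filterS => s sx.
  by rewrite -fh// scalerDr !scalerA (mulrC s).
have /is_derive_line d1 := Ck1_is_derive v open_neq0 Cf x0.
by apply: (is_derive_eq (is_derive_mul (is_derive_const c _ _) d1)); rewrite mul0r add0r.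
Qed.

End smooth_off_origin.

Section anisotropy.
Context {R : realType} {N : nat}.
Variable H : 'rV[R]_N -> R.
Hypothesis hH : admissible_anisotropy H.
Implicit Types (x y z v w : 'rV[R]_N).

Let E : set 'rV[R]_N := [set x | x != 0].

Let CH : Ck 1 E H. Proof. exact: CkS (aniso_C2 hH). Qed.
Let CdH i : Ck 1 E (partial i H).
Proof. by have [_ /(_ i)[]] := aniso_C2 hH. Qed.

Lemma near_gtN1 : \forall s \near (0 : R), 0 < s + 1.
Proof.
have : \forall s \near (0 : R), -1 < s by apply: lt_nbhsr; lra.
by apply: filterS => s; lra.
Qed.

Lemma aniso_euler x : x != 0 -> dot (grad H x) x = H x.
Proof.
move=> x0; apply: (grad_unique CH x0 (h := fun s => (s + 1) * H x)).
  have := near_gtN1; apply: filterS => s s0.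
  by rewrite -(aniso_homogeneous hH)// scalerDl scale1r.
have d1 := is_derive_add (is_derive_id (0 : R) (1 : R)) (is_derive_const 1 (0 : R) 1).
apply: (is_derive_eq (is_derive_mul d1 (is_derive_const (H x) _ _))).
by rewrite mulr0 !addr0 mul1r.
Qed.

Lemma partial_homogeneous i (t : R) x : 0 < t -> x != 0 ->
  partial i H (t *: x) = partial i H x.
Proof.
move=> t0 x0.
have e y : partial i H y = dot (grad H y) (delta_mx 0 i).
  rewrite /dot (bigD1 i)//= big1 ?addr0 => [|j ji]; last first.
    by rewrite !mxE (negbTE ji) mulr0.
  by rewrite !mxE !eqxx mulr1.
apply: (mulfI (lt0r_neq0 t0)); rewrite !e; apply: homogeneous_grad => // y y0.
exact: aniso_homogeneous.
Qed.

(** The second derivative of H as a bilinear form; the second argument is the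
direction in which the gradient is differentiated. *)
Definition hess_form x v w := \sum_i v 0 i * dot (grad (partial i H) x) w.

Lemma hess_formE x v : dot (v *m hessian H x) v = hess_form x v v.
Proof.
rewrite /dot /hess_form /dot; under eq_bigr do rewrite mxE mulr_suml.
rewrite exchange_big/=; apply: eq_bigr => i _; rewrite mulr_sumr.
by apply: eq_bigr => j _; rewrite !mxE mulrA.
Qed.

Lemma hess_form_radial_r x v : x != 0 -> hess_form x v x = 0.
Proof.
move=> x0; rewrite /hess_form big1// => i _.
rewrite (grad_unique (h := fun=> partial i H x) (d := 0)) ?mulr0//.
  have := near_gtN1; apply: filterS => s s0.
  by rewrite -(partial_homogeneous i s0 x0) scalerDl scale1r.
Qed.

(** Differentiate the Euler identity grad H(y).y = H(y) in the direction w. *)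
Lemma hess_form_radial_l x w : x != 0 -> hess_form x x w = 0.
Proof.
move=> x0; apply: (@addIr _ (dot (grad H x) w)); rewrite add0r; apply/esym.
have coord i : is_derive (0 : R) 1 (fun s : R => (s *: w + x) 0 i) (w 0 i).
  have -> : (fun s : R => (s *: w + x) 0 i) = (fun s : R => s * w 0 i + x 0 i).
    by apply/funext => s; rewrite !mxE.
  have d1 := is_derive_mul (is_derive_id (0 : R) (1 : R)) (is_derive_const (w 0 i) (0 : R) (1 : R)).
  apply: (is_derive_eq (is_derive_add d1 (is_derive_const (x 0 i) (0 : R) (1 : R)))).
  by rewrite mulr0 !addr0 mul1r.
have dp i : is_derive (0 : R) 1 (fun s : R => partial i H (s *: w + x))
    (dot (grad (partial i H) x) w).
  exact: (is_derive_line _ _ _ _).1 (Ck1_is_derive w open_neq0 (CdH i) x0).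
apply: (grad_unique CH x0
  (h := \sum_i (fun s : R => partial i H (s *: w + x) * (s *: w + x) 0 i))).
  have := near_line_neq0 w x0; apply: filterS => s sx.
  by rewrite fct_sumE -(aniso_euler sx); apply: eq_bigr => i _; rewrite mxE.
have ds i : is_derive (0 : R) 1
    (fun s : R => partial i H (s *: w + x) * (s *: w + x) 0 i)
    (dot (grad (partial i H) x) w * x 0 i + partial i H x * w 0 i).
  apply: (is_derive_eq (is_derive_mul (dp i) (coord i))).
  by rewrite scale0r add0r.
apply: (is_derive_eq (is_derive_sum ds)).
rewrite big_split/= /hess_form; congr (_ + _); apply: eq_bigr => i _.
  by rewrite mulrC.
by rewrite mxE.
Qed.

Lemma hess_formDr x v w z : hess_form x v (w + z) = hess_form x v w + hess_form x v z.
Proof. by rewrite -big_split; apply: eq_bigr => i _; rewrite dotDr mulrDr. Qed.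

Lemma hess_formZr x v w a : hess_form x v (a *: w) = a * hess_form x v w.
Proof. by rewrite mulr_sumr; apply: eq_bigr => i _; rewrite dotZr mulrCA. Qed.

Lemma hess_formDl x v w z : hess_form x (v + w) z = hess_form x v z + hess_form x w z.
Proof. by rewrite -big_split; apply: eq_bigr => i _; rewrite mxE mulrDl. Qed.

Lemma hess_formZl x v w a : hess_form x (a *: v) w = a * hess_form x v w.
Proof. by rewrite mulr_sumr; apply: eq_bigr => i _; rewrite mxE mulrA. Qed.

(** By homogeneity one may assume H(x) = 1.  Both arguments of the form may then be
changed by multiples of x, so v is replaced by its component in the orthogonal of
grad H(x), where ellipticity holds. *)
Lemma hess_form_ge0 x v : x != 0 -> 0 <= hess_form x v v.
Proof.
move=> x0; have Hx := aniso_gt0 hH x0.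
set t := (H x)^-1; have t0 : 0 < t by rewrite invr_gt0.
have tx0 : t *: x != 0 by rewrite scaler_eq0 negb_or x0 lt0r_neq0.
have -> : hess_form x v v = t * hess_form (t *: x) v v.
  rewrite mulr_sumr; apply: eq_bigr => i _; rewrite mulrCA; congr (_ * _).
  rewrite (homogeneous_grad (c := 1) _ t0 x0 (CdH i)) ?mul1r// => y y0.
  by rewrite mul1r partial_homogeneous.
apply: mulr_ge0; first exact: ltW.
have H1 : H (t *: x) = 1 by rewrite (aniso_homogeneous hH)// mulVf// lt0r_neq0.
move: (t *: x) tx0 H1 => y tx0 H1; set c := dot (grad H y) v.
have [lambda lambda0 ell] := aniso_elliptic hH.
have orth : dot (grad H y) (v - c *: y) = 0.
  by rewrite dotBr dotZr aniso_euler// H1 mulr1 subrr.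
have := ell _ H1 _ orth; rewrite hess_formE.
rewrite -scaleNr hess_formDl !hess_formDr !hess_formZl !hess_formZr.
rewrite hess_form_radial_l// !hess_form_radial_r// !mulr0 !addr0.
by apply: le_trans; rewrite mulr_ge0 ?dot_ge0// ltW.
Qed.

(** The supporting hyperplane inequality of the convex function H; homogeneity
removes the constant term.  On a segment through the origin, where H is not
differentiable, y is a nonpositive multiple of x and the left-hand side is
nonpositive. *)
Lemma aniso_grad_le x y : x != 0 -> dot (grad H x) y <= H y.
Proof.
move=> x0.
have [[t [t01 ty]]|seg] := pselect (exists t : R, 0 <= t <= 1 /\ t *: (y - x) + x = 0).
  have /andP[t0 t1] := t01.
  have tn0 : t != 0.
    by apply: contra_neqN x0 => /eqP te; move: ty; rewrite te scale0r add0r.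
  have tp : 0 < t by rewrite lt0r tn0.
  apply: (@le_trans _ _ 0); last exact: aniso_ge0.
  have : t * dot (grad H x) y = - (1 - t) * H x.
    have : dot (grad H x) (t *: (y - x) + x) = 0 by rewrite ty -(scale0r x) dotZr mul0r.
    by rewrite dotDr dotZr dotBr aniso_euler// => h; lra.
  move=> h; rewrite -(pmulr_rle0 _ tp) h mulNr oppr_le0 mulr_ge0 ?subr_ge0//.
  exact: aniso_ge0.
pose w := y - x.
have nz (t : R) : 0 <= t <= 1 -> t *: w + x != 0.
  by move=> t01; apply/eqP => tw; apply: seg; exists t.
pose g (t : R) := H (t *: w + x).
pose g' (t : R) := dot (grad H (t *: w + x)) w.
have dg (t : R) : 0 <= t <= 1 -> is_derive t 1 g (g' t).
  move=> t01; apply: is_derive_on_line.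
  exact: Ck1_is_derive _ open_neq0 CH (nz _ t01).
have dg' (t : R) : 0 <= t <= 1 -> is_derive t 1 g' (hess_form (t *: w + x) w w).
  move=> t01.
  have -> : g' = \sum_i (fun s : R => w 0 i * partial i H (s *: w + x)).
    by apply/funext => s; rewrite fct_sumE; apply: eq_bigr => i _; rewrite mxE mulrC.
  apply: is_derive_sum => i.
  have dp : is_derive t 1 (fun s : R => partial i H (s *: w + x))
      (dot (grad (partial i H) (t *: w + x)) w).
    by apply: is_derive_on_line; exact: Ck1_is_derive _ open_neq0 (CdH i) (nz _ t01).
  by apply: (is_derive_eq (is_derive_mul (is_derive_const (w 0 i) _ _) dp)); rewrite mul0r add0r.
have [c c01 gE] : exists2 c, c \in `]0, 1[ & g 1 - g 0 = g' c * (1 - 0).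
  apply: MVT => // [t|].
    by rewrite in_itv/= => /andP[t0 t1]; apply: dg; rewrite !ltW.
  apply: derivable_within_continuous => t; rewrite in_itv/= => t01.
  by have [] := dg _ t01.
move: c01; rewrite in_itv/= => /andP[c0 c1].
have [b b01 g'E] : exists2 b, b \in `]0, c[ & g' c - g' 0 = hess_form (b *: w + x) w w * (c - 0).
  apply: MVT => // [t|].
    by rewrite in_itv/= => /andP[t0 t1]; apply: dg'; rewrite !ltW//; lra.
  apply: derivable_within_continuous => t; rewrite in_itv/= => /andP[t0 t1].
  by have [] := dg' t _ => //; apply/andP; split; lra.
move: b01; rewrite in_itv/= => /andP[b0 b1].
have hb : 0 <= hess_form (b *: w + x) w w.
  by apply: hess_form_ge0; apply: nz; apply/andP; split; lra.
have : 0 <= hess_form (b *: w + x) w w * (c - 0) by rewrite mulr_ge0//; lra.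
rewrite -g'E; move: gE; rewrite /g /g' scale1r !scale0r !add0r subrK.
have -> : dot (grad H x) w = dot (grad H x) y - H x by rewrite dotBr aniso_euler.
by rewrite subr0 mulr1 => h1 h2; lra.
Qed.

Lemma aniso_homogeneous0 x (t : R) : 0 <= t -> H (t *: x) = t * H x.
Proof.
rewrite le_eqVlt => /predU1P[<-|t0]; first by rewrite scale0r mul0r (aniso0 hH).
have [->|x0] := eqVneq x 0; first by rewrite scaler0 (aniso0 hH) mulr0.
exact: aniso_homogeneous.
Qed.

Lemma aniso_abs_homogeneous x (t : R) : H (t *: x) = `|t| * H x.
Proof.
have [t0|/ltW t0] := leP 0 t; first by rewrite aniso_homogeneous0// ger0_norm.
by rewrite -(aniso_even hH) -scaleNr aniso_homogeneous0 ?oppr_ge0// ler0_norm.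
Qed.

Lemma aniso_subadditive x y : H (x + y) <= H x + H y.
Proof.
have [xy0|xy0] := eqVneq (x + y) 0.
  by rewrite xy0 (aniso0 hH) addr_ge0//; exact: aniso_ge0.
by rewrite -(aniso_euler xy0) dotDr lerD//; exact: aniso_grad_le.
Qed.

Lemma aniso_le_sum x : H x <= (\sum_i H (delta_mx 0 i)) * \sum_i `|x 0 i|.
Proof.
apply: (@le_trans _ _ (\sum_i `|x 0 i| * H (delta_mx 0 i))).
  rewrite [in leLHS](row_sum_delta x).
  elim/big_rec2 : _ => [|i a b _ ba]; first by rewrite (aniso0 hH).
  apply: (le_trans (aniso_subadditive _ _)); apply: lerD => //.
  by rewrite aniso_abs_homogeneous.
rewrite mulr_sumr; apply: ler_sum => i _; rewrite mulrC ler_wpM2r//.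
rewrite (bigD1 i)//= lerDl sumr_ge0// => j _; exact: aniso_ge0.
Qed.

Variable p : R.
Hypothesis p1 : 1 < p.

Let pB1 : p - 1 != 0. Proof. by apply/lt0r_neq0; rewrite subr_gt0. Qed.

Lemma finsler_fluxE x : finsler_flux H p x = (H x `^ (p - 1)) *: grad H x.
Proof.
rewrite /finsler_flux; case: eqP => // ->.
by rewrite (aniso0 hH) powR0// scale0r.
Qed.

Lemma finsler_flux_self x : dot (finsler_flux H p x) x = H x `^ (p - 1) * H x.
Proof.
rewrite finsler_fluxE dotZl.
have [->|x0] := eqVneq x 0; last by rewrite aniso_euler.
by rewrite (aniso0 hH) mulr0 powR0// mul0r.
Qed.

Lemma finsler_flux_le x y : dot (finsler_flux H p x) y <= H x `^ (p - 1) * H y.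
Proof.
rewrite finsler_fluxE dotZl.
have [->|x0] := eqVneq x 0.
  by rewrite (aniso0 hH) powR0// !mul0r ?aniso_ge0.
by rewrite ler_wpM2l ?powR_ge0//; exact: aniso_grad_le.
Qed.

Lemma finsler_flux_abs_le x y :
  `|dot (finsler_flux H p x) y| <= H x `^ (p - 1) * H y.
Proof.
rewrite ler_norml finsler_flux_le andbT lerNl -dotNr.
by apply: (le_trans (finsler_flux_le x (- y))); rewrite (aniso_even hH).
Qed.

End anisotropy.

(** * Borel sets are Lebesgue measurable *)
Section half_spaces.
Context {R : realType} {N : nat}.
Implicit Types a b : 'rV[R]_N.

Definition cut_hi (i : 'I_N) (c : R) b : 'rV[R]_N :=
  \row_j if j == i then Num.min (b 0 j) c else b 0 j.
Definition cut_lo (i : 'I_N) (c : R) a : 'rV[R]_N :=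
  \row_j if j == i then Num.max (a 0 j) c else a 0 j.

Lemma box_volume_cut i c a b :
  box_volume a (cut_hi i c b) + box_volume (cut_lo i c a) b = box_volume a b.
Proof.
rewrite /box_volume (bigD1 i)//= [X in _ + X](bigD1 i)//= [RHS](bigD1 i)//=.
rewrite !mxE eqxx.
rewrite (eq_bigr (fun j => Num.max 0 (b 0 j - a 0 j))); last first.
  by move=> j /negbTE ji; rewrite !mxE ji.
rewrite [X in _ + _ * X](eq_bigr (fun j => Num.max 0 (b 0 j - a 0 j))); last first.
  by move=> j /negbTE ji; rewrite !mxE ji.
rewrite -mulrDl; congr (_ * _).
case: (leP (b 0 i) c) => h1; case: (leP (a 0 i) c) => h2.
- case: (leP 0 (b 0 i - a 0 i)) => ?; case: (leP 0 (b 0 i - c)) => ?; lra.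
- case: (leP 0 (b 0 i - a 0 i)) => ?; lra.
- case: (leP 0 (c - a 0 i)) => ?; case: (leP 0 (b 0 i - c)) => ?;
    case: (leP 0 (b 0 i - a 0 i)) => ?; lra.
- case: (leP 0 (c - a 0 i)) => ?; case: (leP 0 (b 0 i - a 0 i)) => ?; lra.
Qed.

(** A hyperplane orthogonal to an axis cuts each box of a cover into two boxes with
the same total volume. *)
Lemma measurable_half_space (i : 'I_N) (c : R) :
  measurable ([set x | x 0 i <= c] : set (lebesgueRV R N)).
Proof.
apply: (@le_caratheodory_measurable _ _ (lebesgue_outer_measure R N)) => X.
apply: le_ereal_inf_tmp => _ [[D k] Xk <-].
pose k1 n := ((k n).1, cut_hi i c (k n).2).
pose k2 n := (cut_lo i c (k n).1, (k n).2).
apply: (@le_trans _ _ (cover_volume (D, k1) + cover_volume (D, k2))%E).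
  apply: leeD; apply: ereal_inf_lbound.
    exists (D, k1) => // x [/Xk[n /= Dn xn] /= xc]; exists n => //= j.
    rewrite mxE; have /andP[-> /= xb] := xn j; case: eqP => [->|//].
    by rewrite le_min xc andbT; have /andP[] := xn i.
  exists (D, k2) => // x [/Xk[n /= Dn xn] /= /negP xc]; exists n => //= j.
  rewrite mxE; have /andP[xa ->] := xn j; rewrite andbT; case: eqP => [->|//].
  by rewrite gt_max; have /andP[-> _] := xn i; rewrite /= ltNge.
rewrite /cover_volume/= -esumD; try by move=> n _; exact: box_volume_ge0.
by apply: le_esum => n _; rewrite -EFinD box_volume_cut.
Qed.

Lemma measurable_coord (i : 'I_N) :
  measurable_fun [set: lebesgueRV R N] (fun x : lebesgueRV R N => (x : 'rV[R]_N) 0 i).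
Proof.
apply: (measurability _ (measurable_realfun.RGenOInfty.measurableE R)).
move=> _ [_ [c ->] <-]; rewrite setTI.
rewrite [X in measurable X](_ : _ =
   ~` ([set x | x 0 i <= c] : set (lebesgueRV R N))).
  by apply: measurableC; exact: measurable_half_space.
apply/seteqP; split => x /=; rewrite in_itv/= andbT ltNge; first by move/negP.
by move/negP.
Qed.

End half_spaces.

Section closed_rational_boxes.
Context {R : realType} {N : nat}.

Definition qbox (q : 'rV[rat]_N * 'rV[rat]_N) : set 'rV[R]_N :=
  [set x | forall i, x 0 i \in `[ratr (q.1 0 i), ratr (q.2 0 i)]].

Lemma compact_qbox q : compact (qbox q).
Proof.
have := @rV_compact R N (fun i => `[ratr (q.1 0 i), ratr (q.2 0 i)]%classic).
by move=> /(_ (fun i => @segment_compact _ _ _)); rewrite ord1.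
Qed.

(** Closed boxes are used because they are compact: the same decomposition shows
that open sets are measurable and that they are sigma-compact. *)
Lemma open_qbox (O : set 'rV[R]_N) : open O ->
  O = \bigcup_(q in [set q | qbox q `<=` O]) qbox q.
Proof.
move=> oO; apply/seteqP; split => [x Ox|x [q /= qO]]; last exact: qO.
have /nbhs_ballP[r /= r0 br] : nbhs x O by exact: open_nbhs_nbhs.
have lo i : {q : rat | ratr q \in `]x 0 i - r, x 0 i[}.
  by apply: cid; have [|q] := @rat_in_itvoo R (x 0 i - r) (x 0 i); [lra|exists q].
have hi i : {q : rat | ratr q \in `]x 0 i, x 0 i + r[}.
  by apply: cid; have [|q] := @rat_in_itvoo R (x 0 i) (x 0 i + r); [lra|exists q].
exists (\row_i sval (lo i), \row_i sval (hi i)) => [y /= yq|i] /=.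
  apply: br; split => // k j; rewrite ord1 {k}.
  have := yq j; rewrite /= !mxE; case: (lo j) => a /=; case: (hi j) => b /=.
  rewrite !in_itv/= => /andP[? ?] /andP[? ?] /andP[? ?].
  by rewrite /ball/= ltr_norml; apply/andP; split; lra.
rewrite !mxE; case: (lo i) => a /=; case: (hi i) => b /=.
by rewrite !in_itv/= => /andP[? ?] /andP[? ?]; apply/andP; split; lra.
Qed.

Context d (T : measurableType d).
Implicit Types (D : set T) (V : T -> 'rV[R]_N).

Lemma measurable_preimage_open D V (O : set 'rV[R]_N) : measurable D ->
  (forall i, measurable_fun D (fun z => V z 0 i)) -> open O ->
  measurable (D `&` V @^-1` O).
Proof.
move=> mD mV /open_qbox ->; rewrite preimage_bigcup setI_bigcupr bigcup_mkcond.
apply: countable_bigcupT_measurable => // q; case: ifP => // _.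
rewrite [X in measurable X](_ : _ = D `&` \bigcap_(i in [set: 'I_N])
  (D `&` (fun z => V z 0 i) @^-1` `[ratr (q.1 0 i), ratr (q.2 0 i)]%classic)).
  apply: measurableI => //; apply: fin_bigcap_measurable => // i _.
  by apply: mV => //; exact: measurable_itv.
apply/seteqP; split=> [z [Dz Vz]|z [Dz Vz]]; split => // i.
by move=> _; split => //; exact: Vz.
by have [] := Vz i Logic.I.
Qed.

(** The origin is allowed as an exceptional point because H and its derivatives
are only controlled away from it. *)
Lemma measurable_fun_comp_rV D V (f : 'rV[R]_N -> R) : measurable D ->
  (forall i, measurable_fun D (fun z => V z 0 i)) ->
  (forall x, x != 0 -> {for x, continuous f}) ->
  measurable_fun D (f \o V).
Proof.
move=> mD mV cf; apply: (measurability _ (measurable_realfun.RGenOInfty.measurableE R)).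
move=> _ [_ [c ->] <-].
pose O := [set x | x != 0 /\ c < f x].
have oO : open O.
  rewrite openE => x [x0 cx]; rewrite /interior.
  have h1 : \forall y \near x, y != 0 by exact: (open_nbhs_nbhs (conj open_neq0 x0)).
  have /(cf _ x0) h2 : nbhs (f x) [set z | c < z] by exact: lt_nbhsr.
  exact: filterI h1 h2.
have mO := measurable_preimage_open mD mV oO.
have m0 := measurable_preimage_open mD mV (@open_neq0 R N).
have [c0|c0] := ltP c (f 0).
- rewrite [X in measurable X](_ : _ = (D `&` V @^-1` O) `|`
    (D `\` (D `&` V @^-1` [set x | x != 0]))).
    by apply: measurableU => //; exact: measurableD.
  apply/seteqP; split => z /=; rewrite in_itv/= andbT.
    move=> [Dz cz]; have [V0|V0] := eqVneq (V z) 0; last by left.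
    by right; split => // -[_].
  move=> [[Dz [_ ?]]//|[Dz h]]; split => //.
  have [->//|V0] := eqVneq (V z) 0; by case: h.
- rewrite [X in measurable X](_ : _ = D `&` V @^-1` O)//.
  apply/seteqP; split => z /=; rewrite in_itv/= andbT.
    move=> [Dz cz]; split => //; split => //; apply: contraTneq cz => ->.
    by rewrite -leNgt.
  by move=> [Dz [_ ?]].
Qed.

End closed_rational_boxes.

Section borel_sets.
Context {R : realType} {N : nat}.

Lemma open_measurable_rV (O : set 'rV[R]_N) : open O ->
  measurable (O : set (lebesgueRV R N)).
Proof.
move=> oO.
have := @measurable_preimage_open R N _ (lebesgueRV R N) setT (fun x => x) O
  measurableT (fun i => measurable_coord i) oO.
by rewrite setTI.
Qed.

Lemma compact_measurable_rV (K : set 'rV[R]_N) : compact K ->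
  measurable (K : set (lebesgueRV R N)).
Proof.
move=> cK; rewrite -(setCK K); apply: (@measurableC _ (lebesgueRV R N)).
apply: open_measurable_rV; apply: closed_openC; exact: compact_closed.
Qed.

Lemma continuous_measurable_rV (f : 'rV[R]_N -> R) (D : set (lebesgueRV R N)) :
  measurable D -> continuous f -> measurable_fun D (f : lebesgueRV R N -> R).
Proof.
move=> mD cf; apply: (@measurable_fun_comp_rV R N _ (lebesgueRV R N) D id f mD).
  by move=> i; apply: measurable_funTS; exact: measurable_coord.
by move=> x _; exact: cf.
Qed.

(** Local integrability of F(x,u) gives measurability on compact sets, hence on
the whole open set. *)
Lemma measurable_fun_open (O : set 'rV[R]_N) (f : lebesgueRV R N -> R) :
  open O ->
  (forall K : set 'rV[R]_N, compact K -> K `<=` O ->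
     measurable_fun (K : set (lebesgueRV R N)) f) ->
  measurable_fun (O : set (lebesgueRV R N)) f.
Proof.
move=> oO fK _ Y mY; rewrite {1}(open_qbox oO) setI_bigcupl bigcup_mkcond.
apply: (@countable_bigcupT_measurable _ (lebesgueRV R N)) => // q; case: ifP => // qO.
rewrite inE in qO; apply: fK => //; first exact: compact_qbox.
exact: (compact_measurable_rV (@compact_qbox R N q)).
Qed.

End borel_sets.

(** * Dominated subsequences in L^p *)
Section dominated_subsequence.
Context d (T : measurableType d) (R : realType).
Variables (mu : {measure set T -> \bar R}) (D : set T).
Hypothesis mD : measurable D.
Local Open Scope ereal_scope.

(** Select terms whose integrals are summable.  The sum of the selected functions is
then integrable: it dominates each of them, and where it is finite they tend to 0. *)
Lemma dominated_subsequence (f : nat -> T -> R) :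
  (forall n, measurable_fun D (f n)) -> (forall n x, D x -> (0 <= f n x)%R) ->
  (forall e : R, (0 < e)%R -> exists n, \int[mu]_(x in D) (f n x)%:E <= e%:E) ->
  exists (s : nat -> nat) (g : T -> R) (E : set T),
  [/\ measurable E, mu E = 0, measurable_fun D g,
      mu.-integrable D (EFin \o g) &
      forall x, (D `\` E) x ->
        (forall n, (f (s n) x <= g x)%R) /\
        f (s n) x @[n --> \oo] --> (0 : R)%R].
Proof.
move=> mf f0 fsmall.
have ex n : {m | \int[mu]_(x in D) (f m x)%:E <= (1 / (2 ^ n.+1)%:R)%:E}.
  by apply: cid; apply: fsmall; rewrite divr_gt0// ltr0n expn_gt0.
pose s n := sval (ex n).
pose G x := \sum_(0 <= n <oo) (f (s n) x)%:E.
have fE0 n x : D x -> 0 <= (f (s n) x)%:E by move=> Dx; rewrite lee_fin f0.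
have mfE n : measurable_fun D (EFin \o f (s n)) by apply/measurable_EFinP.
have mG : measurable_fun D G.
  exact: (@ge0_emeasurable_sum _ _ _ D (fun n => EFin \o f (s n)) xpredT
    (fun n x Dx _ => fE0 n x Dx) (fun n _ => mfE n)).
have G0 x : D x -> 0 <= G x by move=> Dx; apply: nneseries_ge0 => n _ _; exact: fE0.
have iG : mu.-integrable D G.
  apply/integrableP; split => //.
  have -> : \int[mu]_(x in D) `|G x| = \int[mu]_(x in D) G x.
    by apply: eq_integral => x /set_mem Dx; rewrite gee0_abs// G0.
  rewrite integral_nneseries//.
  apply: (@le_lt_trans _ _ 1%:E); last exact: ltry.
  have := @epsilon_trick R (fun=> 0) 1%R xpredT (fun=> lexx _) ler01.
  rewrite [X in _ <= X + _]eseries0// add0e; apply: le_trans.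
  apply: lee_nneseries => [n _ _|n _].
    by apply: integral_ge0 => x; exact: fE0.
  by rewrite add0e; exact: (svalP (ex n)).
have [E [mE muE0 hE]] := integrable_ae mD iG.
have GE x : (D `\` E) x -> G x \is a fin_num.
  move=> [Dx nEx]; apply: contrapT => Gx; apply: nEx; apply: hE => /=.
  by move=> /(_ Dx).
have fG x n : D x -> (f (s n) x)%:E <= G x.
  move=> Dx; apply: le_trans (nneseries_lim_ge n.+1 _); last by move=> m _ _; exact: fE0.
  rewrite big_nat_recr//= leeDr// sume_ge0// => i _; exact: fE0.
exists s, (fine \o G), E; split => //.
- exact: measurableT_comp.
- apply: (le_integrable mD _ _ iG).
    by apply/measurable_EFinP; exact: measurableT_comp.
  move=> x Dx; rewrite /= gee0_abs ?G0//.
  by have := G0 _ Dx; case: (G x) => [r r0| |_] //=; rewrite ?leey// lee_fin ger0_norm.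
- move=> x [Dx nEx]; have fx := GE x (conj Dx nEx).
  split=> [n|]; first by rewrite -lee_fin fineK// fG.
  have tail : \sum_(N <= k <oo) (f (s k) x)%:E @[N --> \oo] --> 0.
    apply: (@nneseries_tail_cvg _ (fun k => (f (s k) x)%:E) xpredT).
      by rewrite -ge0_fin_numE ?G0.
    by move=> k _; exact: fE0.
  have lim : (f (s n) x)%:E @[n --> \oo] --> 0.
    apply: squeeze_cvge (cvg_cst 0) tail.
    apply: nearW => n; rewrite fE0//=.
    apply: le_trans (nneseries_lim_ge n.+1 _); last by move=> m _ _; exact: fE0.
    by rewrite big_nat1.
  by have /fine_cvgP[] := lim.
Qed.

End dominated_subsequence.

Section p_integrable.
Context d (T : measurableType d) (R : realType).
Variables (mu : {measure set T -> \bar R}) (D : set T) (p : R).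
Hypotheses (mD : measurable D) (p1 : (1 < p)%R).

Let p0 : 0 < p. Proof. exact: lt_trans ltr01 p1. Qed.

Definition p_integrable (f : T -> R) : Prop :=
  measurable_fun D f /\ mu.-integrable D (fun x => (`|f x| `^ p)%:E).

Lemma measurable_norm_powR (f : T -> R) : measurable_fun D f ->
  measurable_fun D (fun x => `|f x| `^ p).
Proof.
move=> mf; apply: (measurableT_comp (measurable_powR p)).
exact: measurableT_comp.
Qed.

Lemma le_p_integrable (f g : T -> R) : measurable_fun D f ->
  (forall x, D x -> `|f x| <= g x) -> p_integrable g -> p_integrable f.
Proof.
move=> mf fg [mg ig]; split => //; apply: (le_integrable mD _ _ ig).
  by apply/measurable_EFinP; exact: measurable_norm_powR.
move=> x Dx; rewrite /= lee_fin !(ger0_norm (powR_ge0 _ p)).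
have f_g : `|f x| <= `|g x| by apply: (le_trans (fg x Dx)); exact: ler_norm.
by apply: ge0_ler_powR; rewrite ?nnegrE// ltW.
Qed.

Lemma powR_add_le (a b : R) : 0 <= a -> 0 <= b ->
  (a + b) `^ p <= 2 `^ p * (a `^ p + b `^ p).
Proof.
move=> a0 b0.
apply: (@le_trans _ _ ((2 * Num.max a b) `^ p)).
  apply: ge0_ler_powR; rewrite ?nnegrE ?addr_ge0 ?(ltW p0)//.
    by rewrite mulr_ge0// le_max a0.
  by have [ab|ab] := leP a b; lra.
rewrite powRM//; last by rewrite le_max a0.
rewrite ler_wpM2l ?powR_ge0//.
by have [ab|ab] := leP a b; have := powR_ge0 a p; have := powR_ge0 b p; lra.
Qed.

Lemma p_integrableD (f g : T -> R) : p_integrable f -> p_integrable g ->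
  p_integrable (fun x => f x + g x).
Proof.
move=> [mf if_] [mg ig]; split; first exact: measurable_funD.
apply: (le_integrable mD _ _ (integrableZl mD (2 `^ p) (integrableD mD if_ ig))).
  by apply/measurable_EFinP; apply: measurable_norm_powR; exact: measurable_funD.
move=> x Dx; rewrite /= lee_fin (ger0_norm (powR_ge0 _ _)) [leRHS]ger0_norm; last first.
  by rewrite mulr_ge0 ?addr_ge0 ?powR_ge0.
apply: le_trans (powR_add_le (normr_ge0 _) (normr_ge0 _)).
by apply: ge0_ler_powR; rewrite ?nnegrE ?addr_ge0 ?ler_normD ?(ltW p0).
Qed.

Lemma p_integrableZ (c : R) (f : T -> R) : p_integrable f ->
  p_integrable (fun x => c * f x).
Proof.
move=> [mf if_]; split; first by apply: measurable_funM => //; exact: measurable_cst.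
apply: (le_integrable mD _ _ (integrableZl mD (`|c| `^ p) if_)).
  apply/measurable_EFinP; apply: measurable_norm_powR.
  by apply: measurable_funM => //; exact: measurable_cst.
by move=> x Dx; rewrite /= normrM powRM.
Qed.

Lemma p_integrable_norm (f : T -> R) : p_integrable f ->
  p_integrable (fun x => `|f x|).
Proof.
move=> [mf if_]; split; first exact: measurableT_comp.
by under eq_fun do rewrite normr_id.
Qed.

Lemma p_integrable0 : p_integrable (fun=> 0).
Proof.
split; first exact: measurable_cst.
under eq_fun do rewrite normr0 powR0 ?lt0r_neq0 ?(lt_trans _ p1)//.
exact: integrable0.
Qed.

Lemma p_integrable_sum (I : Type) (r : seq I) (f : I -> T -> R) :
  (forall i, p_integrable (f i)) -> p_integrable (fun x => \sum_(i <- r) f i x).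
Proof.
move=> pf; elim: r => [|i r IH].
  by under eq_fun do rewrite big_nil; exact: p_integrable0.
by under eq_fun do rewrite big_cons; exact: p_integrableD.
Qed.

(** A crude Young inequality: replace the smaller of a and b by the larger. *)
Lemma powR_mul_le (a b : R) : 0 <= a -> 0 <= b ->
  a `^ (p - 1) * b <= a `^ p + b `^ p.
Proof.
move=> a0 b0; have pB : 0 <= p - 1 by rewrite subr_ge0 ltW.
rewrite -(mulr_powRB1 a0 p0) -(mulr_powRB1 b0 p0) (mulrC a) (mulrC b).
have [ab|/ltW ab] := leP a b.
  apply: (@le_trans _ _ (b `^ (p - 1) * b)).
    by apply: ler_wpM2r => //; apply: ge0_ler_powR.
  by rewrite lerDr mulr_ge0// powR_ge0.
apply: (@le_trans _ _ (a `^ (p - 1) * a)).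
  by apply: ler_wpM2l => //; exact: powR_ge0.
by rewrite lerDl mulr_ge0// powR_ge0.
Qed.

Lemma integrable_powR_mul (a b : T -> R) :
  (forall x, D x -> 0 <= a x) -> (forall x, D x -> 0 <= b x) ->
  p_integrable a -> p_integrable b ->
  mu.-integrable D (fun x => (a x `^ (p - 1) * b x)%:E).
Proof.
move=> a0 b0 [ma ia] [mb ib].
apply: (le_integrable mD _ _ (integrableD mD ia ib)).
  apply/measurable_EFinP; apply: measurable_funM => //.
  exact: (measurableT_comp (measurable_powR _)).
move=> x Dx; rewrite /= lee_fin !ger0_norm ?a0 ?b0//.
- by apply: powR_mul_le; [exact: a0|exact: b0].
- by rewrite addr_ge0 ?powR_ge0.
- by rewrite mulr_ge0 ?powR_ge0 ?b0.
Qed.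

End p_integrable.

(** * Composition of test functions *)
Section C1_functions.
Context {R : realType} {N : nat}.
Implicit Types (f g phi psi : 'rV[R]_N -> R) (Omega : set 'rV[R]_N).

Lemma Ck1_continuous f : Ck 1 setT f -> continuous f.
Proof. by move=> [cf _] x; exact: cf. Qed.

Lemma Ck1_continuous_partial f i : Ck 1 setT f -> continuous (partial i f).
Proof. by move=> [_ /(_ i)[_ [cf _]]] x; exact: cf. Qed.

Lemma Ck1_is_derive_partial f i x : Ck 1 setT f ->
  is_derive x (delta_mx 0 i) f (partial i f x).
Proof. by move=> [_ /(_ i)[df _]]; apply: DeriveDef => //; exact: df. Qed.

Lemma Ck1_intro f (df : 'I_N -> 'rV[R]_N -> R) : continuous f ->
  (forall i x, is_derive x (delta_mx 0 i) f (df i x)) ->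
  (forall i, continuous (df i)) ->
  Ck 1 setT f /\ (forall i, partial i f = df i).
Proof.
move=> cf fd cd.
have pE i : partial i f = df i.
  by apply/funext => x; have [_] := fd i x.
split => //; split => [x _|i]; first exact: cf.
split => [x _|]; first by have [] := fd i x.
by split => // x _; rewrite pE; exact: cd.
Qed.

Lemma Ck1_comp (G G1 G2 : R -> R -> R) phi psi : C1_bounded G G1 G2 ->
  Ck 1 setT phi -> Ck 1 setT psi ->
  Ck 1 setT (fun x => G (phi x) (psi x)) /\
  forall i x, partial i (fun x => G (phi x) (psi x)) x =
    G1 (phi x) (psi x) * partial i phi x + G2 (phi x) (psi x) * partial i psi x.
Proof.
move=> GC Cphi Cpsi.
have [|||C1 pE] := @Ck1_intro (fun x => G (phi x) (psi x)) (fun i x =>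
    G1 (phi x) (psi x) * partial i phi x + G2 (phi x) (psi x) * partial i psi x).
- move=> x; have [+ _ _] := C1b_cvg GC (nbhs_filter x)
    (@Ck1_continuous phi Cphi x) (@Ck1_continuous psi Cpsi x).
  exact.
- move=> i x; apply: (C1b_chain GC); exact: Ck1_is_derive_partial.
- move=> i x.
  have [_ c1 c2] := C1b_cvg GC (nbhs_filter x)
    (@Ck1_continuous phi Cphi x) (@Ck1_continuous psi Cpsi x).
  have c3 := @Ck1_continuous_partial phi i Cphi x.
  have c4 := @Ck1_continuous_partial psi i Cpsi x.
  exact: (cvgD (cvgM c1 c3) (cvgM c2 c4)).
- by split => // i x; rewrite pE.
Qed.

Lemma Ck1_mul phi psi : Ck 1 setT phi -> Ck 1 setT psi ->
  Ck 1 setT (fun x => phi x * psi x) /\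
  forall i x, partial i (fun x => phi x * psi x) x =
    partial i phi x * psi x + phi x * partial i psi x.
Proof.
move=> Cphi Cpsi.
have [|||C1 pE] := @Ck1_intro (fun x => phi x * psi x) (fun i x =>
    partial i phi x * psi x + phi x * partial i psi x).
- by move=> x; exact: (cvgM (@Ck1_continuous phi Cphi x) (@Ck1_continuous psi Cpsi x)).
- move=> i x; apply: is_derive_mul; exact: Ck1_is_derive_partial.
- move=> i x.
  have c1 := @Ck1_continuous phi Cphi x; have c2 := @Ck1_continuous psi Cpsi x.
  have c3 := @Ck1_continuous_partial phi i Cphi x.
  have c4 := @Ck1_continuous_partial psi i Cpsi x.
  exact: (cvgD (cvgM c3 c2) (cvgM c1 c4)).
- by split => // i x; rewrite pE.
Qed.

(** Two functions phi and psi are needed to treat compositions G(phi, psi) with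
G(0,0) = 0. *)
Lemma csupported_le Omega phi psi f : csupported Omega phi ->
  csupported Omega psi ->
  (forall x, phi x = 0 -> psi x = 0 -> f x = 0) -> csupported Omega f.
Proof.
move=> [cphi sphi] [cpsi spsi] fz.
have sub : closure [set x | f x != 0] `<=`
    closure [set x | phi x != 0] `|` closure [set x | psi x != 0].
  rewrite -closureU; apply: closure_subset => x /= fx.
  have [px|px] := eqVneq (phi x) 0; last by left.
  by right; apply: contra_neq fx => qx; exact: fz.
split; last by move=> x /sub[/sphi|/spsi].
apply: (subclosed_compact _ _ sub); first exact: closed_closure.
exact: compactU.
Qed.

Lemma Cinfty_c_Ck1_c Omega f : Cinfty_c Omega f -> Ck_c 1 Omega f.
Proof. by move=> [Cf sf]; split. Qed.

End C1_functions.

Section cutoffs.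
Context {R : realType}.
Implicit Types d s t : R.

(** A smooth function of s that vanishes at 0 and tends to 1 for s <> 0 as d tends
to 0. *)
Definition cutoff d s := s ^+ 2 / (d ^+ 2 + s ^+ 2).
Definition dcutoff d s := 2 * s * d ^+ 2 / (d ^+ 2 + s ^+ 2) ^+ 2.

Lemma cutoff_den d s : 0 < d -> 0 < d ^+ 2 + s ^+ 2.
Proof. by move=> d0; rewrite ltr_wpDr ?sqr_ge0 ?exprn_gt0. Qed.

Lemma cutoff_itv d s : 0 < d -> 0 <= cutoff d s <= 1.
Proof.
move=> d0; have D0 := cutoff_den s d0.
rewrite /cutoff divr_ge0 ?sqr_ge0 ?(ltW D0)//= ler_pdivrMr// mul1r lerDr.
exact: sqr_ge0.
Qed.

Lemma cutoff0 d : cutoff d 0 = 0.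
Proof. by rewrite /cutoff expr0n mul0r. Qed.

Lemma dcutoff_ge0 d s : 0 <= s -> 0 <= dcutoff d s.
Proof. by move=> s0; rewrite divr_ge0 ?sqr_ge0// mulr_ge0 ?sqr_ge0// mulr_ge0. Qed.

Lemma dcutoff_le d s : 0 < d -> `|dcutoff d s| <= d^-1.
Proof.
move=> d0; have D0 := cutoff_den s d0.
rewrite /dcutoff normrM [X in _ * X]ger0_norm ?invr_ge0 ?sqr_ge0//.
rewrite ler_pdivrMr ?exprn_gt0// ler_pdivlMl//.
rewrite (normrM (2 * s)) (normrM 2) (ger0_norm (sqr_ge0 d)) (ger0_norm (ler0n _ 2)).
rewrite -(real_normK (num_real s)).
have := normr_ge0 s; move: `|s| d d0 {D0} => a b b0 a0.
have : 0 <= (b - a) ^+ 2 by exact: sqr_ge0.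
move=> h; have h1 : 2 * a * b <= b ^+ 2 + a ^+ 2 by nra.
have -> : b * (2 * a * b ^+ 2) = (2 * a * b) * b ^+ 2 by ring.
rewrite [leRHS]expr2; apply: ler_pM => //; rewrite ?sqr_ge0 ?lerDl ?sqr_ge0//.
by rewrite !mulr_ge0// ltW.
Qed.

Lemma cutoff_C1_bounded d : 0 < d ->
  C1_bounded (fun s _ => cutoff d s) (fun s _ => dcutoff d s) (fun _ _ => 0).
Proof.
move=> d0; split.
- move=> V f g x v df dg fd gd.
  have Dn0 : d ^+ 2 + f x * f x != 0 by rewrite -expr2 lt0r_neq0// cutoff_den.
  have d1 := is_derive_mul fd fd.
  have d2 := is_derive_inv (is_derive_add (is_derive_const (d ^+ 2) x v) d1) Dn0.
  apply: (is_derive_eq (is_derive_mul d1 d2)).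
  by rewrite /dcutoff; field.
- move=> T F FF f g s t fs gt.
  have Dn0 : d ^+ 2 + s ^+ 2 != 0 by rewrite lt0r_neq0// cutoff_den.
  have cD : d ^+ 2 + f x ^+ 2 @[x --> F] --> d ^+ 2 + s ^+ 2.
    by apply: cvgD; [exact: cvg_cst|exact: (cvgM fs fs)].
  split; last exact: cvg_cst.
  + by apply: cvgM; [exact: (cvgM fs fs)|exact: cvgV].
  + apply: cvgM.
      by apply: cvgM; [apply: cvgM => //|]; exact: cvg_cst.
    by apply: cvgV; [rewrite expf_neq0|exact: (cvgM cD cD)].
- exists d^-1 => s t; rewrite normr0 invr_ge0 (ltW d0); split => //.
  exact: dcutoff_le.
Qed.

Lemma cutoff_cvg (dn : nat -> R) s : s != 0 -> dn n @[n --> \oo] --> 0 ->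
  cutoff (dn n) s @[n --> \oo] --> (1 : R).
Proof.
move=> s0 d0.
have -> : (1 : R) = s ^+ 2 / (0 * 0 + s ^+ 2).
  by rewrite mul0r add0r divff// sqrf_eq0.
apply: cvgM; first exact: cvg_cst.
apply: cvgV; first by rewrite mul0r add0r sqrf_eq0.
by apply: cvgD; [exact: (cvgM d0 d0)|exact: cvg_cst].
Qed.

(** The value s of the positive part is recovered in the limit d -> 0; for d > 0
the slope is in [0, 1], so the energy bound does not depend on d. *)
Definition regular_pos d s := d * smooth_pos (s / d).

Lemma regular_pos_C1_bounded d : 0 < d ->
  C1_bounded (fun s _ => regular_pos d s) (fun s _ => dsmooth_pos (s / d)) (fun _ _ => 0).
Proof.
move=> d0; have dn0 : d != 0 by rewrite lt0r_neq0.
split.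
- move=> V f g x v df dg fd gd.
  have d1 := is_derive_mul fd (is_derive_const d^-1 x v).
  have d2 := is_derive_comp d1 (is_derive_smooth_pos _).
  apply: (is_derive_eq (is_derive_mul (is_derive_const d x v) d2)).
  by field.
- move=> T F FF f g s t fs gt.
  have c1 : f x / d @[x --> F] --> s / d by apply: cvgM => //; exact: cvg_cst.
  split; last exact: cvg_cst.
  + apply: cvgM; first exact: cvg_cst.
    by apply: cvg_continuous c1; exact: continuous_smooth_pos.
  + by apply: cvg_continuous c1; exact: continuous_dsmooth_pos.
- exists 1 => s t; rewrite normr0 ler01 ger0_norm ?dsmooth_pos_ge0//.
  by split => //; exact: dsmooth_pos_le1.
Qed.

Lemma regular_pos_ge0 d s : 0 < d -> 0 <= regular_pos d s.
Proof. by move=> d0; rewrite mulr_ge0 ?smooth_pos_ge0// ltW. Qed.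

Lemma regular_pos0 d : regular_pos d 0 = 0.
Proof. by rewrite /regular_pos mul0r smooth_pos_le0// mulr0. Qed.

Lemma regular_pos_cvg (dn : nat -> R) s : (forall n, 0 < dn n) -> 0 < s ->
  dn n @[n --> \oo] --> 0 -> regular_pos (dn n) s @[n --> \oo] --> s.
Proof.
move=> dn0 s0 d0.
have jE n : regular_pos (dn n) s = s ^+ 2 / (dn n + s).
  have r0 : 0 < s / dn n by rewrite divr_gt0.
  rewrite /regular_pos /smooth_pos/= max_l ?(ltW r0)//; field.
  by rewrite !lt0r_neq0//= addr_gt0.
have cV : (dn n + s)^-1 @[n --> \oo] --> (0 + s)^-1.
  apply: cvgV; first by rewrite add0r lt0r_neq0.
  exact: (cvgD d0 (cvg_cst s)).
have := cvgM (cvg_cst (s ^+ 2)) cV.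
have -> : s ^+ 2 * (0 + s)^-1 = s by rewrite add0r; field; exact: lt0r_neq0.
have -> : (fun n => regular_pos (dn n) s) = (fun n => s ^+ 2 / (dn n + s)) by apply/funext.
exact.
Qed.

End cutoffs.

Lemma cvg_sumr (R : realType) (I : Type) (r : seq I) (f : I -> nat -> R) (l : I -> R) :
  (forall i, f i n @[n --> \oo] --> l i) ->
  \sum_(i <- r) f i n @[n --> \oo] --> \sum_(i <- r) l i.
Proof.
move=> fl; elim: r => [|i r IH].
  by rewrite big_nil; under eq_fun do rewrite big_nil; exact: cvg_cst.
by rewrite big_cons; under eq_fun do rewrite big_cons; exact: (cvgD (fl i) IH).
Qed.

(** * Flux terms and approximants *)
Section real_dominated_convergence.
Context d (T : measurableType d) (R : realType).
Variables (mu : {measure set T -> \bar R}) (D : set T).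
Hypothesis mD : measurable D.

Lemma real_dominated_convergence (f : nat -> T -> R) (f_lim g : T -> R) :
  (forall n, measurable_fun D (f n)) ->
  (forall x, D x -> f n x @[n --> \oo] --> f_lim x) ->
  mu.-integrable D (EFin \o g) ->
  (forall x n, D x -> `|f n x| <= g x) ->
  mu.-integrable D (EFin \o f_lim) /\
  (\int[mu]_(x in D) (f n x)%:E @[n --> \oo] --> \int[mu]_(x in D) (f_lim x)%:E)%E.
Proof.
move=> mf fl ig fg.
have mfl : measurable_fun D f_lim by exact: measurable_fun_cvg mf fl.
have m1 n : measurable_fun D (EFin \o f n) by apply/measurable_EFinP.
have m2 : measurable_fun D (EFin \o f_lim) by apply/measurable_EFinP.
have a1 : {ae mu, forall x, D x -> (EFin \o f n) x @[n --> \oo] --> (EFin \o f_lim) x}.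
  by apply: aeW => x Dx; apply: cvg_EFin; [exact: nearW|exact: fl].
have a2 : {ae mu, forall x n, D x -> (`|(EFin \o f n) x| <= (EFin \o g) x)%E}.
  by apply: aeW => x n Dx /=; rewrite lee_fin fg.
by have [] := dominated_convergence mD m1 m2 a1 ig a2.
Qed.

End real_dominated_convergence.

Section weak_formulation.
Context {R : realType} {N : nat}.
Variables (Omega : set 'rV[R]_N) (H : 'rV[R]_N -> R) (p : R).
Hypotheses (hH : admissible_anisotropy H) (p1 : 1 < p).
Local Notation T := (lebesgueRV R N).
Local Notation mu := (@lebesgue_rV R N).
Variable D : set T.
Hypotheses (mD : measurable D).

Implicit Types (u v h F : T -> R) (V W Z : T -> 'rV[R]_N).

Local Notation flux := (finsler_flux H p).
Local Notation pint := (@p_integrable _ T R mu D p).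

Definition p_integrable_field V := forall i, pint (fun x => V x 0 i).

Let pB0 : 0 <= p - 1. Proof. by rewrite subr_ge0 ltW. Qed.

Lemma measurable_fun_aniso V : (forall i, measurable_fun D (fun x => V x 0 i)) ->
  measurable_fun D (fun x => H (V x)).
Proof.
move=> mV; apply: (measurable_fun_comp_rV mD mV) => x x0.
by have [cH _] := aniso_C2 hH; exact: cH.
Qed.

Lemma measurable_fun_flux V Z : (forall i, measurable_fun D (fun x => V x 0 i)) ->
  (forall i, measurable_fun D (fun x => Z x 0 i)) ->
  measurable_fun D (fun x => dot (flux (V x)) (Z x)).
Proof.
move=> mV mZ; rewrite /dot; apply: measurable_sum => i.
apply: measurable_funM; last exact: mZ.
have -> : (fun x => flux (V x) 0 i) =
    (fun x => H (V x) `^ (p - 1) * partial i H (V x)).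
  by apply/funext => x; rewrite (finsler_fluxE hH p1) !mxE.
apply: measurable_funM.
  by apply: (measurableT_comp (measurable_powR _)); exact: measurable_fun_aniso.
apply: (measurable_fun_comp_rV mD mV) => x x0.
have [_ /(_ i)[_ [cp _]]] := aniso_C2 hH; exact: cp.
Qed.

Lemma p_integrable_aniso V : p_integrable_field V -> pint (fun x => H (V x)).
Proof.
move=> pV; set c := \sum_i H (delta_mx 0 i).
apply: (@le_p_integrable _ _ _ _ _ _ mD p1 _ (fun x => c * \sum_i `|V x 0 i|)).
- by apply: measurable_fun_aniso => i; have [] := pV i.
- move=> x Dx; rewrite ger0_norm; first exact: aniso_le_sum.
  exact: aniso_ge0.
- apply: (@p_integrableZ _ T R mu D p mD c (fun x => \sum_i `|V x 0 i|)).
  apply: (@p_integrable_sum _ T R mu D p mD p1 _ _ (fun i x => `|V x 0 i|)) => i.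
  exact: p_integrable_norm (pV i).
Qed.

Lemma integrable_aniso V W : p_integrable_field V -> p_integrable_field W ->
  mu.-integrable D (fun x => (H (V x) `^ (p - 1) * H (W x))%:E).
Proof.
move=> pV pW; apply: (@integrable_powR_mul _ T R mu D p mD p1
  (fun x => H (V x)) (fun x => H (W x)));
  try exact: p_integrable_aniso; by move=> x _; exact: aniso_ge0.
Qed.

(** The flux of V is of order H(V)^(p-1) and the fields Z_n are bounded by h, so
the integrands are dominated by H(V)^p + h^p up to constants. *)
Lemma cvg_flux V (Zn : nat -> T -> 'rV[R]_N) Z h : p_integrable_field V -> pint h ->
  (forall n i, measurable_fun D (fun x => Zn n x 0 i)) ->
  (forall x i, D x -> Zn n x 0 i @[n --> \oo] --> Z x 0 i) ->
  (forall x n i, D x -> `|Zn n x 0 i| <= h x) ->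
  mu.-integrable D (fun x => (dot (flux (V x)) (Z x))%:E) /\
  (\int[mu]_(x in D) (dot (flux (V x)) (Zn n x))%:E @[n --> \oo] -->
    \int[mu]_(x in D) (dot (flux (V x)) (Z x))%:E)%E.
Proof.
move=> pV ph mZ ZnZ Znh; set c := \sum_i H (delta_mx 0 i).
have mV i : measurable_fun D (fun x => V x 0 i) by have [] := pV i.
apply: (@real_dominated_convergence _ T R mu D mD
  (fun n x => dot (flux (V x)) (Zn n x)) (fun x => dot (flux (V x)) (Z x))
  (fun x => H (V x) `^ (p - 1) * (c * \sum_(i < N) `|h x|))).
- by move=> n; exact: measurable_fun_flux.
- move=> x Dx; apply: cvg_sumr => i.
  exact: (cvgM (cvg_cst _) (ZnZ x i Dx)).
- apply: (@integrable_powR_mul _ T R mu D p mD p1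
    (fun x => H (V x)) (fun x => c * \sum_(i < N) `|h x|)).
  + by move=> x _; exact: aniso_ge0.
  + move=> x _; rewrite mulr_ge0 ?sumr_ge0// => i _; exact: aniso_ge0.
  + exact: p_integrable_aniso.
  + apply: (@p_integrableZ _ T R mu D p mD c (fun x => \sum_(i < N) `|h x|)).
    apply: (@p_integrable_sum _ T R mu D p mD p1 _ _ (fun i x => `|h x|)) => i.
    exact: p_integrable_norm ph.
- move=> x n Dx; apply: (le_trans (finsler_flux_abs_le hH p1 _ _)).
  rewrite ler_wpM2l ?powR_ge0//; apply: (le_trans (aniso_le_sum hH _)).
  rewrite ler_wpM2l ?sumr_ge0//; first by move=> i _; exact: aniso_ge0.
  apply: ler_sum => i _; apply: (le_trans (Znh x n i Dx)); exact: ler_norm.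
Qed.

(** Everything is required pointwise on D, a set from which the null set of
exceptional points has been removed. *)
Record approximated (u : T -> R) (V : T -> 'rV[R]_N)
    (phi : nat -> 'rV[R]_N -> R) (g : T -> R) : Prop := {
  ap_C1 : forall n, Ck_c 1 Omega (phi n);
  ap_cvg : forall x, D x -> phi n x @[n --> \oo] --> u x;
  ap_grad : forall x i, D x -> partial i (phi n) x @[n --> \oo] --> V x 0 i;
  ap_dom : forall x n i, D x -> `|partial i (phi n) x| <= g x;
  ap_pint : pint g }.

Lemma ap_measurable_partial u V phi g : approximated u V phi g ->
  forall n i, measurable_fun D (partial i (phi n) : T -> R).
Proof.
move=> au n i; apply: continuous_measurable_rV => //.
by apply: Ck1_continuous_partial; have [] := ap_C1 au n.
Qed.

Lemma ap_measurable u V phi g : approximated u V phi g ->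
  forall n, measurable_fun D (phi n : T -> R).
Proof.
move=> au n; apply: continuous_measurable_rV => //.
by apply: Ck1_continuous; have [] := ap_C1 au n.
Qed.

Lemma ap_measurable_lim u V phi g : approximated u V phi g -> measurable_fun D u.
Proof. by move=> au; exact: measurable_fun_cvg (ap_measurable au) (ap_cvg au). Qed.

Lemma ap_dom_lim u V phi g : approximated u V phi g ->
  forall x i, D x -> `|V x 0 i| <= g x.
Proof.
move=> au x i Dx.
have c1 : `|partial i (phi n) x| @[n --> \oo] --> `|V x 0 i|.
  by apply: cvg_norm; exact: (@ap_grad _ _ _ _ au x i Dx).
rewrite -(cvg_lim (@Rhausdorff R) c1); apply: limr_le.
  by apply/cvg_ex; exists (`|V x 0 i|).
by apply: nearW => n; exact: (@ap_dom _ _ _ _ au x n i Dx).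
Qed.

Lemma ap_measurable_field u V phi g : approximated u V phi g ->
  forall i, measurable_fun D (fun x => V x 0 i).
Proof.
move=> au i; apply: (measurable_fun_cvg (fun n => ap_measurable_partial au n i)).
by move=> x Dx; exact: (@ap_grad _ _ _ _ au x i Dx).
Qed.

Lemma ap_p_integrable_field u V phi g : approximated u V phi g -> p_integrable_field V.
Proof.
move=> au i; apply: (le_p_integrable mD p1 _ _ (ap_pint au)).
  exact: (ap_measurable_field au).
by move=> x Dx; exact: (@ap_dom_lim _ _ _ _ au x i Dx).
Qed.

End weak_formulation.

(** * Testing the equations with functions of u and v *)
Section fatou_bound.
Context d (T : measurableType d) (R : realType).
Variables (mu : {measure set T -> \bar R}) (D : set T).
Hypothesis mD : measurable D.
Local Open Scope ereal_scope.

Lemma fatou_bound (f : nat -> T -> R) (f_lim : T -> R) (a : nat -> \bar R) l :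
  (forall n, measurable_fun D (f n)) -> (forall n x, D x -> (0 <= f n x)%R) ->
  (forall x, D x -> f n x @[n --> \oo] --> f_lim x) ->
  (forall n, \int[mu]_(x in D) (f n x)%:E <= a n) -> a n @[n --> \oo] --> l ->
  \int[mu]_(x in D) (f_lim x)%:E <= l.
Proof.
move=> mf f0 fl fa al.
have mfE n : measurable_fun D (EFin \o f n) by apply/measurable_EFinP.
have f0E n x : D x -> 0 <= (EFin \o f n) x by move=> Dx; rewrite lee_fin f0.
have -> : \int[mu]_(x in D) (f_lim x)%:E =
    \int[mu]_(x in D) limn_einf (fun n => (EFin \o f n) x).
  apply: eq_integral => x /set_mem Dx.
  have c : (f n x)%:E @[n --> \oo] --> (f_lim x)%:E.
    by apply: cvg_EFin; [exact: nearW|exact: fl].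
  rewrite is_cvg_limn_einfE; first by apply/esym/cvg_lim.
  by apply/cvg_ex; exists (f_lim x)%:E.
apply: (le_trans (fatou mu mD mfE f0E)).
rewrite -(cvg_lim (@ereal_hausdorff R) al) -is_cvg_limn_einfE; last first.
  by apply/cvg_ex; exists l.
rewrite !limn_einf_lim; apply: lee_lim.
- exact: is_cvg_einfs.
- exact: is_cvg_einfs.
- apply: nearW => n; apply: le_ereal_inf_tmp => _ [m /= nm <-].
  by apply: le_trans (fa m); apply: ereal_inf_lbound; exists m.
Qed.

Lemma cvge_le_bound (a : nat -> \bar R) l b :
  a n @[n --> \oo] --> l -> (forall n, a n <= b) -> l <= b.
Proof.
move=> al ab; rewrite -(cvg_lim (@ereal_hausdorff R) al).
by apply: lime_le; [apply/cvg_ex; exists l|exact: nearW].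
Qed.

End fatou_bound.

Section testing.
Context {R : realType} {N : nat}.
Variables (Omega : set 'rV[R]_N) (H : 'rV[R]_N -> R) (p : R).
Hypotheses (hH : admissible_anisotropy H) (p1 : 1 < p).
Local Notation T := (lebesgueRV R N).
Local Notation mu := (@lebesgue_rV R N).
Variable D : set T.
Hypotheses (mD : measurable D) (DO : D `<=` Omega).
Local Notation flux := (finsler_flux H p).
Local Notation pint := (@p_integrable _ T R mu D p).

(** The equation of a solution u, where Y stands for its weak gradient and F for
the function x |-> F(x,u(x)).  The integrals are over D, which is meant to be
Omega minus a null set, while the test functions live on Omega. *)
Record flux_equation (Y : T -> 'rV[R]_N) (F : T -> R) : Prop := {
  fe_pint : p_integrable_field p D Y;
  fe_measurable : measurable_fun D F;
  fe_ge0 : forall x, D x -> 0 <= F x;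
  fe_L1loc : forall K : set 'rV[R]_N, compact K -> K `<=` Omega ->
    mu.-integrable (K : set T) (EFin \o F);
  fe_eq : forall f, Ck_c 1 Omega f ->
    (\int[mu]_(x in D) (dot (flux (Y x)) (grad f x))%:E =
     \int[mu]_(x in D) (F x * f x)%:E)%E }.

Variables (u v : T -> R) (V W : T -> 'rV[R]_N).
Variables (phi psi : nat -> 'rV[R]_N -> R) (g h : T -> R).
Hypotheses (au : approximated Omega p D u V phi g).
Hypotheses (av : approximated Omega p D v W psi h).

(** The weak gradient of G(u, v). *)
Definition chain_field (G1 G2 : R -> R -> R) (x : T) : 'rV[R]_N :=
  G1 (u x) (v x) *: V x + G2 (u x) (v x) *: W x.

Section one_test.
Variables (G G1 G2 : R -> R -> R).
Hypothesis GC : C1_bounded G G1 G2.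

Lemma measurable_fun_comp2 : [/\ measurable_fun D (fun x => G (u x) (v x)),
  measurable_fun D (fun x => G1 (u x) (v x)) &
  measurable_fun D (fun x => G2 (u x) (v x))].
Proof.
have cG x : D x -> [/\ G (phi n x) (psi n x) @[n --> \oo] --> G (u x) (v x),
    G1 (phi n x) (psi n x) @[n --> \oo] --> G1 (u x) (v x) &
    G2 (phi n x) (psi n x) @[n --> \oo] --> G2 (u x) (v x)].
  by move=> Dx; apply: (C1b_cvg GC); [exact: (ap_cvg au)|exact: (ap_cvg av)].
have cont (a b : 'rV[R]_N -> R) : continuous a -> continuous b ->
    [/\ continuous (fun x => G (a x) (b x)),
        continuous (fun x => G1 (a x) (b x)) &
        continuous (fun x => G2 (a x) (b x))].
  by move=> c1 c2; split=> x; have [] := C1b_cvg GC (nbhs_filter x) (c1 x) (c2 x).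
have cn n := cont (phi n) (psi n) (Ck1_continuous (ap_C1 au n).1)
  (Ck1_continuous (ap_C1 av n).1).
split.
- apply: (@measurable_fun_cvg _ T R D (fun n (x : T) => G (phi n x) (psi n x))
    (fun x => G (u x) (v x))) => [n|x /cG[]//].
  by apply: continuous_measurable_rV => //; have [] := cn n.
- apply: (@measurable_fun_cvg _ T R D (fun n (x : T) => G1 (phi n x) (psi n x))
    (fun x => G1 (u x) (v x))) => [n|x /cG[]//].
  by apply: continuous_measurable_rV => //; have [] := cn n.
- apply: (@measurable_fun_cvg _ T R D (fun n (x : T) => G2 (phi n x) (psi n x))
    (fun x => G2 (u x) (v x))) => [n|x /cG[]//].
  by apply: continuous_measurable_rV => //; have [] := cn n.
Qed.

Lemma test_Ck1 n : Ck 1 setT (fun x => G (phi n x) (psi n x)) /\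
  forall i x, partial i (fun x => G (phi n x) (psi n x)) x =
    G1 (phi n x) (psi n x) * partial i (phi n) x +
    G2 (phi n x) (psi n x) * partial i (psi n) x.
Proof. exact: Ck1_comp GC (ap_C1 au n).1 (ap_C1 av n).1. Qed.

Lemma test_partial_le : exists2 k : T -> R, pint k &
  (forall n x i, D x ->
    `|partial i (fun x => G (phi n x) (psi n x)) x| <= k x) /\
  (forall x i, D x -> `|chain_field G1 G2 x 0 i| <= k x).
Proof.
have [C GCb] := C1b_bound GC.
exists (fun x => C * (g x + h x)).
  apply: (@p_integrableZ _ T R mu D p mD C (fun x => g x + h x)).
  exact: (@p_integrableD _ T R mu D p mD p1 g h (ap_pint au) (ap_pint av)).
split=> [n x i Dx|x i Dx].
- rewrite (test_Ck1 n).2 mulrDr; apply: (le_trans (ler_normD _ _)).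
  rewrite !normrM; have [b1 b2] := GCb (phi n x) (psi n x).
  apply: lerD; apply: ler_pM => //.
    exact: (@ap_dom _ _ _ _ _ _ _ _ _ au x n i Dx).
  exact: (@ap_dom _ _ _ _ _ _ _ _ _ av x n i Dx).
- rewrite !mxE mulrDr; apply: (le_trans (ler_normD _ _)).
  rewrite !normrM; have [b1 b2] := GCb (u x) (v x).
  apply: lerD; apply: ler_pM => //.
    exact: (@ap_dom_lim _ _ _ _ _ _ _ _ _ au x i Dx).
  exact: (@ap_dom_lim _ _ _ _ _ _ _ _ _ av x i Dx).
Qed.

Lemma cvg_test_partial x i : D x ->
  partial i (fun x => G (phi n x) (psi n x)) x @[n --> \oo] -->
  chain_field G1 G2 x 0 i.
Proof.
move=> Dx; rewrite !mxE.
have [_ c1 c2] := C1b_cvg GC _ (@ap_cvg _ _ _ _ _ _ _ _ _ au x Dx)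
  (@ap_cvg _ _ _ _ _ _ _ _ _ av x Dx).
have c3 := @ap_grad _ _ _ _ _ _ _ _ _ au x i Dx.
have c4 := @ap_grad _ _ _ _ _ _ _ _ _ av x i Dx.
have -> : (fun n => partial i (fun x => G (phi n x) (psi n x)) x) =
   (fun n => G1 (phi n x) (psi n x) * partial i (phi n) x +
    G2 (phi n x) (psi n x) * partial i (psi n) x).
  by apply/funext => n; rewrite (test_Ck1 n).2.
exact: (cvgD (cvgM c1 c3) (cvgM c2 c4)).
Qed.

Lemma measurable_chain_field i : measurable_fun D (fun x => chain_field G1 G2 x 0 i).
Proof.
have [_ m1 m2] := measurable_fun_comp2.
have -> : (fun x => chain_field G1 G2 x 0 i) =
    (fun x => G1 (u x) (v x) * V x 0 i + G2 (u x) (v x) * W x 0 i).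
  by apply/funext => x; rewrite !mxE.
exact: (measurable_funD (measurable_funM m1 (ap_measurable_field mD au i))
  (measurable_funM m2 (ap_measurable_field mD av i))).
Qed.

Variables (Y : T -> 'rV[R]_N) (F : T -> R).
Hypothesis feY : flux_equation Y F.

(** G(phi_n, psi_n) is a test function because G(0,0) = 0.  The supports of the
approximants are not contained in a common compact set, so only the Fatou lemma is
available for the right-hand side. *)
Lemma fatou_test : (forall s t, 0 <= G s t) -> G 0 0 = 0 ->
  mu.-integrable D (fun x => (dot (flux (Y x)) (chain_field G1 G2 x))%:E) /\
  (\int[mu]_(x in D) (F x * G (u x) (v x))%:E <=
   \int[mu]_(x in D) (dot (flux (Y x)) (chain_field G1 G2 x))%:E)%E.
Proof.
move=> G0 G00; have [k pk [k1 k2]] := test_partial_le.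
pose f n x := G (phi n x) (psi n x).
have fC n : Ck_c 1 Omega (f n).
  split; first exact: (test_Ck1 n).1.
  apply: (csupported_le (ap_C1 au n).2 (ap_C1 av n).2) => x.
  by rewrite /f => -> ->.
have [|||ig cv] := @cvg_flux R N H p hH p1 D mD Y (fun n x => grad (f n) x)
  (chain_field G1 G2) k (fe_pint feY) pk.
- move=> n i.
  have -> : (fun x => grad (f n) x 0 i) = partial i (f n).
    by apply/funext => x; rewrite mxE.
  apply: continuous_measurable_rV => //; apply: Ck1_continuous_partial.
  exact: (fC n).1.
- move=> x i Dx; under eq_fun do rewrite mxE.
  exact: cvg_test_partial.
- by move=> x n i Dx; rewrite mxE; exact: k1.
split => //; apply: (fatou_bound (f := fun n x => F x * f n x) mD _ _ _ _ cv).
- move=> n; apply: (@measurable_funM _ T R D F (f n) (fe_measurable feY)).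
  apply: continuous_measurable_rV => //; apply: Ck1_continuous.
  exact: (fC n).1.
- by move=> n x Dx; apply: mulr_ge0; [exact: (fe_ge0 feY)|exact: G0].
- move=> x Dx; apply: (cvgM (cvg_cst _)).
  by have [] := C1b_cvg GC _ (@ap_cvg _ _ _ _ _ _ _ _ _ au x Dx)
    (@ap_cvg _ _ _ _ _ _ _ _ _ av x Dx).
- by move=> n; rewrite (fe_eq feY).
Qed.

(** All the functions zeta G(phi_n, psi_n) are supported in the support of zeta,
where F is integrable: the right-hand side passes to the limit too. *)
Lemma cutoff_test C zeta (z : T -> R) : (forall s t, `|G s t| <= C) ->
  Ck_c 1 Omega zeta -> (forall x, `|zeta x| <= 1) -> pint z ->
  (forall x i, D x -> `|partial i zeta x| <= z x) ->
  (\int[mu]_(x in D) (dot (flux (Y x))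
      (G (u x) (v x) *: grad zeta x + zeta x *: chain_field G1 G2 x))%:E =
   \int[mu]_(x in D) (F x * (zeta x * G (u x) (v x)))%:E)%E.
Proof.
move=> GB [C1z sz] z1 pz zz; have [k pk [k1 k2]] := test_partial_le.
pose f n x := zeta x * G (phi n x) (psi n x).
have fM n := Ck1_mul C1z (test_Ck1 n).1.
have fC n : Ck_c 1 Omega (f n).
  split; first exact: (fM n).1.
  by apply: (csupported_le sz sz) => x; rewrite /f => -> _; rewrite mul0r.
have C0 : 0 <= C by apply: (le_trans (normr_ge0 (G 0 0))).
have cG x : D x -> G (phi n x) (psi n x) @[n --> \oo] --> G (u x) (v x).
  by move=> Dx; have [] := C1b_cvg GC _ (@ap_cvg _ _ _ _ _ _ _ _ _ au x Dx)
    (@ap_cvg _ _ _ _ _ _ _ _ _ av x Dx).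
have [||||ig cv] := @cvg_flux R N H p hH p1 D mD Y (fun n x => grad (f n) x)
  (fun x => G (u x) (v x) *: grad zeta x + zeta x *: chain_field G1 G2 x)
  (fun x => C * z x + k x) (fe_pint feY).
- apply: (@p_integrableD _ T R mu D p mD p1 (fun x => C * z x) k _ pk).
  exact: (@p_integrableZ _ T R mu D p mD C z).
- move=> n i.
  have -> : (fun x => grad (f n) x 0 i) = partial i (f n).
    by apply/funext => x; rewrite mxE.
  apply: continuous_measurable_rV => //; apply: Ck1_continuous_partial.
  exact: (fC n).1.
- move=> x i Dx.
  have -> : (fun n => grad (f n) x 0 i) = (fun n => partial i zeta x * G (phi n x) (psi n x)
     + zeta x * partial i (fun x => G (phi n x) (psi n x)) x).
    by apply/funext => n; rewrite mxE (fM n).2.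
  rewrite mxE [X in _ --> X + _]mxE [X in _ --> _ + X]mxE mxE [G _ _ * _]mulrC.
  apply: cvgD; first exact: (cvgM (cvg_cst _) (cG x Dx)).
  by apply: (cvgM (cvg_cst _)); exact: cvg_test_partial.
- move=> x n i Dx; rewrite mxE (fM n).2; apply: (le_trans (ler_normD _ _)).
  rewrite !normrM; apply: lerD.
    by rewrite mulrC; apply: ler_pM => //; exact: zz.
  by rewrite -[leRHS]mul1r; apply: ler_pM => //; exact: k1.
pose K := closure [set x | zeta x != 0].
have cK : compact K by case: sz.
have [||||ig2 cv2] := @real_dominated_convergence _ T R mu D mD
  (fun n x => F x * f n x) (fun x => F x * (zeta x * G (u x) (v x)))
  ((fun x => C * `|F x|) \_ K).
- move=> n; apply: (@measurable_funM _ T R D F (f n) (fe_measurable feY)).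
  apply: continuous_measurable_rV => //; apply: Ck1_continuous.
  exact: (fC n).1.
- move=> x Dx; apply: (cvgM (cvg_cst _)).
  exact: (cvgM (cvg_cst _) (cG x Dx)).
- have mK : measurable (K : set T) by exact: compact_measurable_rV.
  apply: (integrableS measurableT) => //.
  have -> : EFin \o ((fun x => C * `|F x|) \_ K) =
      (fun x => C%:E * `|F x|%:E)%E \_ K.
    by apply/funext => x; rewrite /= /patch; case: ifP => // _; rewrite EFinM.
  apply/(integrable_mkcond _ mK)/(integrableZl mK).
  have := integrable_abse (fe_L1loc feY cK _); apply.
  by case: sz.
- move=> x n Dx; rewrite /patch; case: ifPn => [_|xK].
    rewrite mulrC normrM; apply: ler_wpM2r => //.
    rewrite normrM -[leRHS]mul1r; exact: ler_pM.
  rewrite /f (_ : zeta x = 0) ?mul0r ?mulr0 ?normr0//; apply/eqP.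
  by apply: contraNT xK => zx; rewrite inE; exact: subset_closure.
have e : (fun n => \int[mu]_(x in D) (dot (flux (Y x)) (grad (f n) x))%:E)%E =
         (fun n => \int[mu]_(x in D) (F x * f n x)%:E)%E.
  by apply/funext => n; rewrite (fe_eq feY).
rewrite e in cv.
by rewrite -(cvg_lim (@ereal_hausdorff R) cv) -(cvg_lim (@ereal_hausdorff R) cv2).
Qed.

End one_test.
End testing.

Lemma lincomb_coord (R : realType) (N : nat) (a b : R) (x y : 'rV[R]_N) i :
  (a *: x + b *: y) 0 i = a * x 0 i + b * y 0 i.
Proof. by rewrite !mxE. Qed.

Lemma grad_coord (R : realType) (N : nat) (f : 'rV[R]_N -> R) x i :
  grad f x 0 i = partial i f x.
Proof. by rewrite mxE. Qed.

(** * Removing the cutoff *)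
Section exact_test.
Context {R : realType} {N : nat}.
Variables (Omega : set 'rV[R]_N) (H : 'rV[R]_N -> R) (p : R).
Hypotheses (hH : admissible_anisotropy H) (p1 : 1 < p).
Local Notation T := (lebesgueRV R N).
Local Notation mu := (@lebesgue_rV R N).
Variable D : set T.
Hypotheses (mD : measurable D).
Local Notation flux := (finsler_flux H p).
Local Notation pint := (@p_integrable _ T R mu D p).

Variables (u v : T -> R) (V W : T -> 'rV[R]_N).
Variables (phi psi : nat -> 'rV[R]_N -> R) (g h : T -> R).
Hypotheses (au : approximated Omega p D u V phi g).
Hypotheses (av : approximated Omega p D v W psi h).
Hypothesis u_gt0 : forall x, D x -> 0 < u x.
Variable F : T -> R.
Hypothesis feV : flux_equation Omega H p D V F.
Variables (G G1 G2 : R -> R -> R) (C : R).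
Hypothesis GC : C1_bounded G G1 G2.
Hypothesis G_itv : forall s t, 0 <= G s t <= C.
Local Notation Z := (chain_field u v V W G1 G2).

Let G_norm s t : `|G s t| <= C.
Proof. by have /andP[? ?] := G_itv s t; rewrite ger0_norm. Qed.

Let iZ : mu.-integrable D (fun x => (dot (flux (V x)) (Z x))%:E).
Proof.
have [k pk [_ k2]] := test_partial_le p1 mD au av GC.
have mZ i := measurable_chain_field mD au av GC i.
have [|||+ _] := @cvg_flux R N H p hH p1 D mD V (fun _ => Z) Z k (fe_pint feV) pk.
- by [].
- by move=> x i _; exact: cvg_cst.
- by move=> x _ i Dx; exact: k2.
- exact.
Qed.

Let mfZ : measurable_fun D (fun x => dot (flux (V x)) (Z x)).
Proof. by apply/measurable_EFinP; have /integrableP[] := iZ. Qed.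

Lemma measurable_cutoff (d : R) : 0 < d -> measurable_fun D (fun x => cutoff d (u x)).
Proof.
move=> d0.
by have [] := measurable_fun_comp2 mD au av (cutoff_C1_bounded d0).
Qed.

(** Use zeta_n = cutoff d (phi_n) and let n tend to infinity.  On the right-hand
side zeta_n <= 1 is enough.  On the left-hand side the derivative of the cutoff
contributes G dcutoff A(V).V >= 0, which is discarded. *)
Lemma cutoff_upper_test (d : R) : 0 < d ->
  (\int[mu]_(x in D) (cutoff d (u x) * dot (flux (V x)) (Z x))%:E <=
   \int[mu]_(x in D) (F x * G (u x) (v x))%:E)%E.
Proof.
move=> d0; have qC := cutoff_C1_bounded d0.
have [k pk [_ k2]] := test_partial_le p1 mD au av GC.
have C0 : 0 <= C by apply: (le_trans (normr_ge0 (G 0 0))).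
pose zeta n x := cutoff d (phi n x).
have zC n := Ck1_comp qC (ap_C1 au n).1 (ap_C1 au n).1.
have zE n i x : partial i (zeta n) x = dcutoff d (phi n x) * partial i (phi n) x.
  by rewrite (zC n).2 mul0r addr0.
have zCc n : Ck_c 1 Omega (zeta n).
  split; first exact: (zC n).1.
  apply: (csupported_le (ap_C1 au n).2 (ap_C1 au n).2) => x.
  by rewrite /zeta => -> _; rewrite cutoff0.
have z1 n x : `|zeta n x| <= 1.
  by have /andP[? ?] := cutoff_itv (phi n x) d0; rewrite ger0_norm.
have pz : pint (fun x => d^-1 * g x).
  exact: (@p_integrableZ _ T R mu D p mD d^-1 g (ap_pint au)).
have zz n x i : D x -> `|partial i (zeta n) x| <= d^-1 * g x.
  move=> Dx; rewrite zE normrM; apply: ler_pM => //; first exact: dcutoff_le.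
  exact: (@ap_dom _ _ _ _ _ _ _ _ _ au x n i Dx).
have eqn n := cutoff_test hH p1 mD au av GC feV G_norm (zCc n) (z1 n) pz (zz n).
have mG : measurable_fun D (fun x => G (u x) (v x)).
  by have [] := measurable_fun_comp2 mD au av GC.
pose Zl (x : T) := G (u x) (v x) *: (dcutoff d (u x) *: V x) + cutoff d (u x) *: Z x.
have [||||ig cv] := @cvg_flux R N H p hH p1 D mD V
  (fun n x => G (u x) (v x) *: grad (zeta n) x + zeta n x *: Z x) Zl
  (fun x => C * (d^-1 * g x) + k x) (fe_pint feV).
- apply: (@p_integrableD _ T R mu D p mD p1 (fun x => C * (d^-1 * g x)) k _ pk).
  exact: (@p_integrableZ _ T R mu D p mD C (fun x => d^-1 * g x)).
- move=> n i.
  have -> : (fun x => (G (u x) (v x) *: grad (zeta n) x + zeta n x *: Z x) 0 i) =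
    (fun x => G (u x) (v x) * partial i (zeta n) x + zeta n x * Z x 0 i).
    by apply/funext => x; rewrite lincomb_coord grad_coord.
  have m1 : measurable_fun D (partial i (zeta n) : T -> R).
    apply: continuous_measurable_rV => //; apply: Ck1_continuous_partial.
    exact: (zC n).1.
  have m2 : measurable_fun D (zeta n : T -> R).
    by apply: continuous_measurable_rV => //; apply: Ck1_continuous; exact: (zC n).1.
  have m3 := measurable_chain_field mD au av GC i.
  exact: (measurable_funD (measurable_funM mG m1) (measurable_funM m2 m3)).
- move=> x i Dx.
  have -> : (fun n => (G (u x) (v x) *: grad (zeta n) x + zeta n x *: Z x) 0 i) =
    (fun n => G (u x) (v x) * (dcutoff d (phi n x) * partial i (phi n) x)
       + cutoff d (phi n x) * Z x 0 i).
    by apply/funext => n; rewrite -zE lincomb_coord grad_coord.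
  have -> : Zl x 0 i = G (u x) (v x) * (dcutoff d (u x) * V x 0 i)
       + cutoff d (u x) * Z x 0 i.
    by rewrite lincomb_coord mxE.
  have c0 := @ap_cvg _ _ _ _ _ _ _ _ _ au x Dx.
  have [c1 c2 _] := C1b_cvg qC _ c0 c0.
  have c3 := @ap_grad _ _ _ _ _ _ _ _ _ au x i Dx.
  apply: cvgD; last exact: (cvgM c1 (cvg_cst _)).
  by apply: (cvgM (cvg_cst _)); exact: (cvgM c2 c3).
- move=> x n i Dx; rewrite lincomb_coord grad_coord.
  apply: (le_trans (ler_normD _ _)).
  rewrite (normrM (G _ _)) (normrM (zeta n x)); apply: lerD.
    by apply: ler_pM => //; exact: zz.
  by rewrite -[leRHS]mul1r; apply: ler_pM => //; exact: k2.
have up : (\int[mu]_(x in D) (dot (flux (V x)) (Zl x))%:E <=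
    \int[mu]_(x in D) (F x * G (u x) (v x))%:E)%E.
  apply: (cvge_le_bound cv) => n; rewrite eqn; apply: ge0_le_integral; first exact: mD.
  - move=> x Dx; have /andP[? _] := cutoff_itv (phi n x) d0.
    have /andP[? _] := G_itv (u x) (v x).
    by rewrite lee_fin; apply: mulr_ge0; [exact: (fe_ge0 feV)|exact: mulr_ge0].
  - apply/measurable_EFinP; apply: (measurable_funM (fe_measurable feV)).
    apply: (@measurable_funM _ T R D (zeta n) (fun x => G (u x) (v x)) _ mG).
    by apply: continuous_measurable_rV => //; apply: Ck1_continuous; exact: (zC n).1.
  - by apply/measurable_EFinP; exact: (measurable_funM (fe_measurable feV) mG).
  - move=> x Dx; have /andP[? ?] := cutoff_itv (phi n x) d0.
    have /andP[? _] := G_itv (u x) (v x).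
    rewrite lee_fin; apply: ler_wpM2l; first exact: (fe_ge0 feV).
    by rewrite -[leRHS]mul1r; apply: ler_wpM2r.
apply: le_trans up; apply: (le_integral mD _ ig).
- apply: (le_integrable mD _ _ iZ).
    apply/measurable_EFinP.
    exact: (measurable_funM (measurable_cutoff d0) mfZ).
  move=> x Dx; rewrite /= lee_fin normrM -[leRHS]mul1r; apply: ler_pM => //.
  by have /andP[? ?] := cutoff_itv (u x) d0; rewrite ger0_norm.
- move=> x /set_mem Dx; rewrite lee_fin /Zl.
  move: (Z x) => Zx; rewrite dotDr !dotZr lerDr.
  rewrite (finsler_flux_self hH p1) mulr_ge0//; first by have /andP[] := G_itv (u x) (v x).
  rewrite mulr_ge0 ?dcutoff_ge0 ?(ltW (u_gt0 Dx))// mulr_ge0 ?powR_ge0//.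
  exact: aniso_ge0.
Qed.

Lemma upper_test :
  (\int[mu]_(x in D) (dot (flux (V x)) (Z x))%:E <=
   \int[mu]_(x in D) (F x * G (u x) (v x))%:E)%E.
Proof.
have d0 n : 0 < (@harmonic R n) by exact: harmonic_gt0.
have [||||_ cv] := @real_dominated_convergence _ T R mu D mD
  (fun n x => cutoff (harmonic n) (u x) * dot (flux (V x)) (Z x))
  (fun x => dot (flux (V x)) (Z x)) (fun x => `|dot (flux (V x)) (Z x)|).
- by move=> n; exact: (measurable_funM (measurable_cutoff (d0 n)) mfZ).
- move=> x Dx; rewrite -[X in _ --> X]mul1r.
  apply: cvgM; last exact: cvg_cst.
  apply: cutoff_cvg; first exact: lt0r_neq0 (u_gt0 Dx).
  exact: cvg_harmonic.
- by have := integrable_abse iZ.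
- move=> x n Dx; rewrite normrM -[leRHS]mul1r; apply: ler_pM => //.
  by have /andP[? ?] := cutoff_itv (u x) (d0 n); rewrite ger0_norm.
apply: (cvge_le_bound cv) => n; exact: cutoff_upper_test.
Qed.

End exact_test.

(** * Pointwise approximation in W^{1,p}_0 *)
Section Lp_norm.
Context d (T : measurableType d) (R : realType).
Variables (mu : {measure set T -> \bar R}) (D : set T) (p : R).
Hypotheses (mD : measurable D) (p1 : 1 < p).

Let p0 : 0 < p. Proof. exact: lt_trans ltr01 p1. Qed.

Lemma Lnorm_restrict (f : T -> R) :
  ((Lnorm mu p%:E (EFin \o (f \_ D))) `^ p =
   \int[mu]_(x in D) (`|f x| `^ p)%:E)%E.
Proof.
rewrite poweR_Lnorm; last exact: lt0r_neq0.
rewrite [RHS]integral_mkcond; apply: eq_integral => x _.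
rewrite /patch /=; case: ifP => // _.
by rewrite normr0 powR0// lt0r_neq0.
Qed.

Lemma Lfun_p_integrable (f : T -> R) : f \_ D \in Lfun mu p%:E ->
  p_integrable mu D p f.
Proof.
rewrite inE => /andP[]; rewrite inE/= => mf; rewrite inE/= /finite_norm => nf.
have mDf : measurable_fun D f.
  rewrite -[D]setTI; apply/(measurable_restrict f mD measurableT).
  exact: mf.
split => //; apply/integrableP; split.
  by apply/measurable_EFinP; exact: measurable_norm_powR.
have -> : (\int[mu]_(x in D) `|(`|f x| `^ p)%:E| = \int[mu]_(x in D) (`|f x| `^ p)%:E)%E.
  by apply: eq_integral => x _; rewrite gee0_abs// lee_fin powR_ge0.
by rewrite -Lnorm_restrict; exact: poweR_lty.
Qed.

Lemma Lnorm_cvg_small (f : nat -> T -> R) :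
  (fun n => Lnorm mu p%:E (EFin \o ((f n) \_ D))) @ \oo --> 0%E ->
  forall e : R, 0 < e ->
  \forall n \near \oo, (\int[mu]_(x in D) (`|f n x| `^ p)%:E <= e%:E)%E.
Proof.
move=> /fine_cvgP[ffin /cvgrPdist_lt fl] e e0.
have e'0 : 0 < e `^ p^-1 by rewrite powR_gt0.
have := fl _ e'0; move: ffin; apply: filterS2 => n ffn.
rewrite /= sub0r normrN => fle; rewrite -Lnorm_restrict.
rewrite -(fineK ffn) poweR_EFin lee_fin.
have N0 : 0 <= fine (Lnorm mu p%:E (EFin \o f n \_ D)) by exact/fine_ge0/Lnorm_ge0.
rewrite ger0_norm// in fle.
have -> : e = (e `^ p^-1) `^ p by rewrite -powRrM mulVf ?lt0r_neq0// powRr1// ltW.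
by apply: ge0_ler_powR; rewrite ?nnegrE ?powR_ge0 ?(ltW p0)// ltW.
Qed.

Lemma powR_small_cvg0 (a b : nat -> R) : (forall n, `|a n| `^ p <= b n) ->
  b n @[n --> \oo] --> (0 : R) -> a n @[n --> \oo] --> (0 : R).
Proof.
move=> ab /cvgrPdist_lt b0; apply/cvgrPdist_lt => e e0.
have := b0 _ (powR_gt0 p e0); apply: filterS => n; rewrite !sub0r !normrN => bn.
rewrite ltNge; apply/negP => ea.
have : e `^ p <= `|a n| `^ p by apply: ge0_ler_powR; rewrite ?nnegrE ?(ltW p0)// ltW.
have := ab n; have := ler_norm (b n); lra.
Qed.

End Lp_norm.

Section approximation.
Context {R : realType} {N : nat}.
Variables (Omega : set 'rV[R]_N) (p : R).
Hypotheses (oO : open Omega) (p1 : 1 < p).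
Local Notation T := (lebesgueRV R N).
Local Notation mu := (@lebesgue_rV R N).

Let p0 : 0 < p. Proof. exact: lt_trans ltr01 p1. Qed.
Let mO : measurable (Omega : set T). Proof. exact: open_measurable_rV. Qed.

Lemma approximated_subset (D D' : set T) u V phi g : measurable D ->
  measurable D' -> D' `<=` D ->
  approximated Omega p D u V phi g -> approximated Omega p D' u V phi g.
Proof.
move=> mD mD' D'D [C1 c g' dom [mg ig]]; split => //.
- by move=> x /D'D; exact: c.
- by move=> x i /D'D; exact: g'.
- by move=> x n i /D'D; exact: dom.
- by split; [exact: measurable_funS mg|exact: integrableS ig].
Qed.

(** Apply [dominated_subsequence] to the sum of the p-th powers of the errors on
the function and on all its partial derivatives. *)
Lemma W1p0_approximated u V : W1p0 p Omega u V ->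
  exists (phi : nat -> 'rV[R]_N -> R) (g : T -> R) (E : set T),
  [/\ measurable E, mu E = 0%E & approximated Omega p (Omega `\` E) u V phi g].
Proof.
move=> [[Lu LV _] [phi [Cphi cu cV]]].
have [mu_ _] := Lfun_p_integrable mO p1 Lu.
have pV i := Lfun_p_integrable mO p1 (LV i).
have mV i : measurable_fun (Omega : set T) (fun x : T => V x 0 i) by have [] := pV i.
have mphi n : measurable_fun (Omega : set T) (phi n : T -> R).
  apply: continuous_measurable_rV => //; apply: Ck1_continuous.
  exact: (Cinfty_c_Ck1_c (Cphi n)).1.
have mdphi n i : measurable_fun (Omega : set T) (partial i (phi n) : T -> R).
  apply: continuous_measurable_rV => //; apply: Ck1_continuous_partial.
  exact: (Cinfty_c_Ck1_c (Cphi n)).1.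
pose f0 n (x : T) := `|phi n x - u x| `^ p.
pose fi i n (x : T) := `|partial i (phi n) x - V x 0 i| `^ p.
have mf0 n : measurable_fun (Omega : set T) (f0 n).
  by apply: measurable_norm_powR; exact: measurable_funB.
have mfi i n : measurable_fun (Omega : set T) (fi i n).
  by apply: measurable_norm_powR; exact: measurable_funB.
pose f n (x : T) := f0 n x + \sum_i fi i n x.
have msum n : measurable_fun (Omega : set T) (fun x => \sum_i fi i n x).
  by apply: measurable_sum => i; exact: mfi.
have [||e e0|s [gg [E [mE E0 mgg igg hE]]]] := @dominated_subsequence _ T R mu Omega mO f.
- by move=> n; exact: measurable_funD.
- move=> n x _; rewrite addr_ge0 ?powR_ge0// sumr_ge0// => i _; exact: powR_ge0.
(* The error on u and the N errors on its partial derivatives get equal shares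
   of e. *)
- pose e' := e / N.+1%:R.
  have e'0 : 0 < e' by rewrite divr_gt0.
  have n0 := Lnorm_cvg_small p1 cu e'0.
  have ni i := Lnorm_cvg_small p1 (cV i) e'0.
  have nall : \forall n \near \oo, forall i,
      (\int[mu]_(x in (Omega : set T)) (fi i n x)%:E <= e'%:E)%E.
    exact: (@filter_forall _ _ (fun i n =>
      (\int[mu]_(x in (Omega : set T)) (fi i n x)%:E <= e'%:E)%E) \oo _ ni).
  have [n [h0 hi]] := filter_ex (filterI n0 nall).
  exists n; rewrite /f.
  under eq_integral do rewrite EFinD -sumEFin.
  rewrite (ge0_integralD mu mO); last 4 first.
  + by move=> x _; rewrite lee_fin powR_ge0.
  + exact/measurable_EFinP.
  + by move=> x _; rewrite sume_ge0// => i _; rewrite lee_fin powR_ge0.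
  + by under eq_fun do rewrite sumEFin; exact/measurable_EFinP.
  rewrite (ge0_integral_sum mu mO); last 2 first.
  + by move=> i; exact/measurable_EFinP.
  + by move=> i x _; rewrite lee_fin powR_ge0.
  have -> : (e%:E = e'%:E + \sum_(i < N) e'%:E)%E.
    rewrite sumEFin sumr_const card_ord -EFinD; congr EFin.
    by rewrite -mulrS -[RHS]mulr_natr /e' divfK// pnatr_eq0.
  by apply: leeD => //; apply: lee_sum => i _; exact: hi.
pose g (x : T) := \sum_i `|V x 0 i| + `|gg x| `^ p^-1.
have hf x n i : fi i (s n) x <= f (s n) x.
  rewrite /f (bigD1 i)//= addrCA lerDl; apply: addr_ge0; first exact: powR_ge0.
  by apply: sumr_ge0 => j _; exact: powR_ge0.
have hf0 x n : f0 (s n) x <= f (s n) x.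
  by rewrite /f lerDl; apply: sumr_ge0 => i _; exact: powR_ge0.
exists (phi \o s), g, E; split => //; split.
- by move=> n; exact: Cinfty_c_Ck1_c (Cphi _).
- move=> x Dx; apply/subr_cvg0.
  apply: (powR_small_cvg0 p1 (b := fun n => f (s n) x)).
    by move=> n; exact: hf0.
  exact: (hE x Dx).2.
- move=> x i Dx; apply/subr_cvg0.
  apply: (powR_small_cvg0 p1 (b := fun n => f (s n) x)).
    by move=> n; exact: hf.
  exact: (hE x Dx).2.
- move=> x n i Dx; rewrite /g.
  have -> : partial i ((phi \o s) n) x =
    V x 0 i + (partial i (phi (s n)) x - V x 0 i) by rewrite addrC subrK.
  apply: (le_trans (ler_normD _ _)); apply: lerD.
    by rewrite (bigD1 i)//= lerDl sumr_ge0.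
  have -> : `|partial i (phi (s n)) x - V x 0 i| = (fi i (s n) x) `^ p^-1.
    by rewrite /fi -powRrM mulfV ?lt0r_neq0// powRr1.
  apply: ge0_ler_powR; rewrite ?nnegrE ?powR_ge0 ?invr_ge0 ?(ltW p0)//.
  apply: (le_trans (hf x n i)); apply: (le_trans ((hE x Dx).1 n)).
  exact: ler_norm.
- have mD : measurable (Omega `\` E : set T) by exact: measurableD.
  have pg : p_integrable mu (Omega : set T) p g.
    apply: (@p_integrableD _ T R mu Omega p mO p1 (fun x => \sum_i `|V x 0 i|)
      (fun x => `|gg x| `^ p^-1)).
      apply: (@p_integrable_sum _ T R mu Omega p mO p1 _ _ (fun i x => `|V x 0 i|)) => i.
      exact: p_integrable_norm (pV i).
    split.
      apply: (measurableT_comp (measurable_powR _)); exact: measurableT_comp.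
    have -> : (fun x => (`| `|gg x| `^ p^-1| `^ p)%:E) = (abse \o (EFin \o gg)).
      apply/funext => x; rewrite /= ger0_norm ?powR_ge0// -powRrM mulVf ?lt0r_neq0//.
      by rewrite powRr1.
    exact: integrable_abse.
  have [mg ig] := pg; split.
    by apply: measurable_funS mg => //; exact: subDsetl.
  by apply: integrableS ig => //; exact: subDsetl.
Qed.

End approximation.

(** * Comparison and uniqueness *)
Section comparison.
Context {R : realType} {N : nat}.
Variables (Omega : set 'rV[R]_N) (H : 'rV[R]_N -> R) (p : R).
Hypotheses (hH : admissible_anisotropy H) (p1 : 1 < p).
Local Notation T := (lebesgueRV R N).
Local Notation mu := (@lebesgue_rV R N).
Variable D : set T.
Hypotheses (mD : measurable D).
Local Notation flux := (finsler_flux H p).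

Variables (u v : T -> R) (V W : T -> 'rV[R]_N).
Variables (phi psi : nat -> 'rV[R]_N -> R) (g h : T -> R).
Hypotheses (au : approximated Omega p D u V phi g).
Hypotheses (av : approximated Omega p D v W psi h).
Hypothesis u_gt0 : forall x, D x -> 0 < u x.
Hypothesis v_gt0 : forall x, D x -> 0 < v x.
Variables Fu Fv : T -> R.
Hypothesis feV : flux_equation Omega H p D V Fu.
Hypothesis feW : flux_equation Omega H p D W Fv.

Let mu_ : measurable_fun D u := ap_measurable_lim mD au.

(** The test functions regular_pos d (u) have energy at most that of u and
increase to u as d tends to 0. *)
Lemma energy_bound : mu.-integrable D (fun x => (Fu x * u x)%:E).
Proof.
have iE := integrable_aniso hH p1 mD (fe_pint feV) (fe_pint feV).
have d0 n : 0 < (@harmonic R n) by exact: harmonic_gt0.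
have m1 : measurable_fun D (fun x => Fu x * u x).
  exact: (measurable_funM (fe_measurable feV) mu_).
apply/integrableP; split; first exact/measurable_EFinP.
have -> : (\int[mu]_(x in D) `|(Fu x * u x)%:E| = \int[mu]_(x in D) (Fu x * u x)%:E)%E.
  apply: eq_integral => x /set_mem Dx; rewrite gee0_abs// lee_fin.
  by apply: mulr_ge0; [exact: (fe_ge0 feV)|exact/ltW/u_gt0].
apply: (@le_lt_trans _ _ (\int[mu]_(x in D) (H (V x) `^ (p - 1) * H (V x))%:E)%E); last first.
  have /integrableP[_] := iE; apply: le_lt_trans.
  apply: (le_integral mD iE (integrable_abse iE)).
  by move=> x _; exact: lee_abs.
have mj n : measurable_fun D (fun x => regular_pos (harmonic n) (u x)).
  by have [] := measurable_fun_comp2 mD au av (regular_pos_C1_bounded (d0 n)).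
apply: (fatou_bound (f := fun n x => Fu x * regular_pos (harmonic n) (u x)) mD _ _ _ _
  (cvg_cst _)).
- by move=> n; exact: (measurable_funM (fe_measurable feV) (mj n)).
- move=> n x Dx; apply: mulr_ge0; first exact: (fe_ge0 feV).
  exact: regular_pos_ge0.
- move=> x Dx; apply: (cvgM (cvg_cst _)); apply: regular_pos_cvg => //.
    exact: u_gt0.
  exact: cvg_harmonic.
- move=> n.
  have [||ig low] := fatou_test hH p1 mD au av (regular_pos_C1_bounded (d0 n)) feV.
  + by move=> s _; exact: regular_pos_ge0.
  + exact: regular_pos0.
  apply: (le_trans low); apply: (le_integral mD ig iE).
  move=> x _; rewrite lee_fin /chain_field scale0r addr0 dotZr.
  rewrite (finsler_flux_self hH p1) -[leRHS]mul1r ler_wpM2r ?dsmooth_pos_le1//.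
  by rewrite mulr_ge0 ?powR_ge0//; exact: aniso_ge0.
Qed.

Let e n : R := harmonic n.
Let e_gt0 n : 0 < e n. Proof. exact: harmonic_gt0. Qed.
Let k n : R := n%:R.
Let k_ge0 n : 0 <= k n. Proof. exact: ler0n. Qed.
Let pB0 : 0 <= p - 1. Proof. by rewrite subr_ge0 ltW. Qed.

Let w a n (x : T) := picone_test a (e n) (k n) (u x) (v x).
Let err n (x : T) := 2 * (1 - dtrunc (k n) (u x)) * (H (V x) `^ (p - 1) * H (W x)).

Let measurable_w a n : 0 <= a -> measurable_fun D (w a n).
Proof.
move=> a0.
by have [] := measurable_fun_comp2 mD au av (picone_test_C1_bounded a0 (e_gt0 n) (k_ge0 n)).
Qed.

Let err_props : (forall n, mu.-integrable D (EFin \o err n)) /\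
  (\int[mu]_(x in D) (err n x)%:E @[n --> \oo] --> 0)%E.
Proof.
have iE := integrable_aniso hH p1 mD (fe_pint feV) (fe_pint feW).
have mE : measurable_fun D (fun x => H (V x) `^ (p - 1) * H (W x)).
  by apply/measurable_EFinP; have /integrableP[] := iE.
have m1 n : measurable_fun D (err n).
  have mT : measurable_fun D (fun x => dtrunc (k n) (u x)).
    apply: (measurableT_comp (f := dtrunc (k n)) _ mu_).
    by apply: continuous_measurable_fun; exact: continuous_dtrunc.
  have m2 := measurable_funM (measurable_cst (2 : R))
    (measurable_funB (measurable_cst (1 : R)) mT).
  exact: (measurable_funM m2 mE).
have ie : mu.-integrable D (EFin \o (fun x => 2 * (H (V x) `^ (p - 1) * H (W x)))).
  exact: (integrableZl mD 2 iE).
have en n x : D x -> `|err n x| <= 2 * (H (V x) `^ (p - 1) * H (W x)).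
  move=> Dx; have E0 : 0 <= H (V x) `^ (p - 1) * H (W x).
    by rewrite mulr_ge0 ?powR_ge0//; exact: aniso_ge0.
  have /andP[t0 t1] := dtrunc_itv (k n) (u x).
  have t2 : 0 <= 1 - dtrunc (k n) (u x) by rewrite subr_ge0.
  rewrite /err ger0_norm; last by rewrite mulr_ge0// mulr_ge0.
  by rewrite ler_wpM2r//; lra.
split.
  move=> n; apply: (le_integrable mD _ _ ie); first exact/measurable_EFinP.
  move=> x Dx; rewrite /= lee_fin; apply: (le_trans (en n x Dx)); exact: ler_norm.
have [||//|x n Dx|_] := @real_dominated_convergence _ T R mu D mD err (fun=> 0)
  (fun x => 2 * (H (V x) `^ (p - 1) * H (W x))).
- exact: m1.
- move=> x Dx; apply: cvg_near_cst.
  near=> n; rewrite /err dtrunc_small ?subrr ?mulr0 ?mul0r//.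
  by near: n; exact: nbhs_infty_ger.
- exact: en.
- by rewrite integral0.
Unshelve. all: by end_near. Qed.

(** The Fatou inequality for the equation of v, the Picone inequality, and the
inequality without cutoff for the equation of u are chained. *)
Lemma test_comparison n :
  (\int[mu]_(x in D) (Fv x * w (p - 1) n x)%:E <=
   \int[mu]_(x in D) (Fu x * w 0 n x)%:E + \int[mu]_(x in D) (err n x)%:E)%E.
Proof.
have C1 := picone_test_C1_bounded (lexx 0) (e_gt0 n) (k_ge0 n).
have C2 := picone_test_C1_bounded pB0 (e_gt0 n) (k_ge0 n).
have [C wC] := picone_test_bounded (lexx 0) (e_gt0 n) (k_ge0 n).
have up := upper_test hH p1 mD au av u_gt0 feV C1
  (fun s t => introT andP (conj (picone_test_ge0 0 (k n) s t (e_gt0 n)) (wC s t))).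
have [||i2 low] := fatou_test hH p1 mD au av C2 feW.
- by move=> s t; exact: picone_test_ge0.
- exact: picone_test00.
have [||i1 _] := fatou_test hH p1 mD au av C1 feV.
- by move=> s t; exact: picone_test_ge0.
- exact: picone_test00.
apply: (le_trans low).
pose Z (x : T) := chain_field u v V W
  (picone_test1 0 (e n) (k n)) (picone_test2 0 (e n) (k n)) x.
apply: (@le_trans _ _
  (\int[mu]_(x in D) ((dot (flux (V x)) (Z x))%:E + (err n x)%:E))%E).
  apply: (le_integral mD i2 (integrableD mD i1 (err_props.1 n))).
  move=> x /set_mem Dx; rewrite -EFinD lee_fin /Z /chain_field !dotDr !dotZr.
  apply: picone_inequality => //; try exact: aniso_ge0; try exact/ltW/u_gt0; try exact/ltW/v_gt0.
  - exact: finsler_flux_self.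
  - exact: finsler_flux_self.
  - exact: finsler_flux_le.
  - exact: finsler_flux_le.
rewrite (integralD mD i1 (err_props.1 n)).
by apply: leeD.
Qed.

Let lim_w a x : D x -> w a n x @[n --> \oo] --> u x * weight a (u x / v x).
Proof.
move=> Dx.
have cT : trunc (e n) (k n) (u x) @[n --> \oo] --> u x.
  apply: (@cvg_trans _ ((e n + u x) @[n --> \oo])).
    apply: near_eq_cvg; near=> n; rewrite trunc_small//.
    by near: n; exact: nbhs_infty_ger.
  by have := cvgD (@cvg_harmonic R) (cvg_cst (u x)); rewrite add0r; exact.
have cS : lift_pos (e n) (v x) @[n --> \oo] --> v x.
  have -> : (fun n => lift_pos (e n) (v x)) = (fun n => e n + v x).
    by apply/funext => n; rewrite lift_pos_nneg// ltW// v_gt0.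
  by have := cvgD (@cvg_harmonic R) (cvg_cst (v x)); rewrite add0r; exact.
apply: cvgM => //; apply: cvg_continuous; first exact: continuous_weight.
by apply: cvgM => //; apply: cvgV => //; exact/lt0r_neq0/v_gt0.
Unshelve. all: by end_near. Qed.

Hypothesis decr : forall x, D x -> v x < u x ->
  Fu x / u x `^ (p - 1) < Fv x / v x `^ (p - 1).

Let delta (x : T) := Fv x * (u x * weight (p - 1) (u x / v x)) -
  Fu x * (u x * weight 0 (u x / v x)).

Let delta_gt0 x : D x -> v x < u x -> 0 < delta x.
Proof.
move=> Dx vu; have u0 := u_gt0 Dx; have v0 := v_gt0 Dx.
have r1 : 1 < u x / v x by rewrite ltr_pdivlMr// mul1r.
have q0 : 0 < weight 0 (u x / v x).
  rewrite /weight max_l ?(ltW r1)// mulr_gt0 ?powR_gt0 ?divr_gt0//.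
  by rewrite exprn_gt0// subr_gt0 invf_lt1// (lt_trans ltr01).
have qE : weight (p - 1) (u x / v x) = (u x / v x) `^ (p - 1) * weight 0 (u x / v x).
  by rewrite /weight max_l ?(ltW r1)// powRr0 mul1r.
have U0 : 0 < u x `^ (p - 1) by exact: powR_gt0.
have V0 : 0 < v x `^ (p - 1) by exact: powR_gt0.
have rE : (u x / v x) `^ (p - 1) = u x `^ (p - 1) / v x `^ (p - 1).
  by rewrite powRM ?invr_ge0 ?ltW// -powRN -powR_inv1 ?ltW// -powRrM mulN1r.
have := decr Dx vu; rewrite ltr_pdivrMr// => dd.
rewrite /delta qE rE.
have -> : Fv x * (u x * (u x `^ (p - 1) / v x `^ (p - 1) * weight 0 (u x / v x))) -
    Fu x * (u x * weight 0 (u x / v x)) =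
    (u x * weight 0 (u x / v x)) * (Fv x / v x `^ (p - 1) * u x `^ (p - 1) - Fu x) by ring.
by apply: mulr_gt0; [exact: mulr_gt0|rewrite subr_gt0].
Qed.

Let delta_ge0 x : D x -> 0 <= delta x.
Proof.
move=> Dx; have [uv|vu] := leP (u x) (v x); last exact/ltW/delta_gt0.
have r1 : u x / v x <= 1 by rewrite ler_pdivrMr ?mul1r ?v_gt0.
by rewrite /delta !weight_le1// !mulr0 subrr.
Qed.

Lemma comparison : {ae mu, forall x, D x -> u x <= v x}.
Proof.
(* The integrable majorant F(x,u) u of F(x,u) w1 makes the integrands
   nonnegative. *)
pose f n (x : T) := (Fu x * u x - Fu x * w 0 n x) + Fv x * w (p - 1) n x.
have iu := energy_bound.
have mFu := measurable_funM (fe_measurable feV) mu_.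
have mw0 n := measurable_funM (fe_measurable feV) (measurable_w n (lexx 0)).
have mwp n := measurable_funM (fe_measurable feW) (measurable_w n pB0).
have w_le n x : D x -> Fu x * w 0 n x <= Fu x * u x.
  move=> Dx; apply: ler_wpM2l; first exact: (fe_ge0 feV).
  by apply: picone_test_le_id => //; apply: ltW; [exact: u_gt0|exact: v_gt0].
have w_ge a n x : 0 <= w a n x by exact: picone_test_ge0.
have f1_ge0 n x : D x -> (0 <= (Fu x * u x - Fu x * w 0 n x)%:E)%E.
  by move=> Dx; rewrite lee_fin subr_ge0 w_le.
have f2_ge0 n x : D x -> (0 <= (Fv x * w (p - 1) n x)%:E)%E.
  by move=> Dx; rewrite lee_fin; apply: mulr_ge0; [exact: (fe_ge0 feW)|].
have f3_ge0 n x : D x -> (0 <= (Fu x * w 0 n x)%:E)%E.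
  by move=> Dx; rewrite lee_fin; apply: mulr_ge0; [exact: (fe_ge0 feV)|].
have mf1 n := measurable_funB mFu (mw0 n).
have mf n : measurable_fun D (f n) := measurable_funD (mf1 n) (mwp n).
have e1 n : measurable_fun D (fun x => (Fu x * u x - Fu x * w 0 n x)%:E).
  by apply/measurable_EFinP; exact: mf1.
have e2 n : measurable_fun D (fun x => (Fv x * w (p - 1) n x)%:E).
  by apply/measurable_EFinP; exact: mwp.
have e3 n : measurable_fun D (fun x => (Fu x * w 0 n x)%:E).
  by apply/measurable_EFinP; exact: mw0.
have fl x : D x -> f n x @[n --> \oo] --> Fu x * u x + delta x.
  move=> Dx.
  have -> : Fu x * u x + delta x = Fu x * u x - Fu x * (u x * weight 0 (u x / v x))
      + Fv x * (u x * weight (p - 1) (u x / v x)) by rewrite /delta; ring.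
  have c1 : Fu x * w 0 n x @[n --> \oo] --> Fu x * (u x * weight 0 (u x / v x)).
    exact: (cvgM (cvg_cst _) (@lim_w 0 x Dx)).
  have c2 : Fv x * w (p - 1) n x @[n --> \oo] -->
      Fv x * (u x * weight (p - 1) (u x / v x)).
    exact: (cvgM (cvg_cst _) (@lim_w (p - 1) x Dx)).
  exact: (cvgD (cvgB (cvg_cst (Fu x * u x)) c1) c2).
have fle n : (\int[mu]_(x in D) (f n x)%:E <=
    \int[mu]_(x in D) (Fu x * u x)%:E + \int[mu]_(x in D) (err n x)%:E)%E.
  have -> : (\int[mu]_(x in D) (f n x)%:E =
      \int[mu]_(x in D) (Fu x * u x - Fu x * w 0 n x)%:E +
      \int[mu]_(x in D) (Fv x * w (p - 1) n x)%:E)%E.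
    by rewrite -(ge0_integralD mu mD (f1_ge0 n) (e1 n) (f2_ge0 n) (e2 n)).
  have <- : (\int[mu]_(x in D) (Fu x * u x - Fu x * w 0 n x)%:E +
      \int[mu]_(x in D) (Fu x * w 0 n x)%:E = \int[mu]_(x in D) (Fu x * u x)%:E)%E.
    rewrite -(ge0_integralD mu mD (f1_ge0 n) (e1 n) (f3_ge0 n) (e3 n)).
    by apply: eq_integral => x _; rewrite -EFinD subrK.
  rewrite -addeA; apply: leeD => //; exact: test_comparison.
have al : (\int[mu]_(x in D) (Fu x * u x)%:E + \int[mu]_(x in D) (err n x)%:E)%E
    @[n --> \oo] --> (\int[mu]_(x in D) (Fu x * u x)%:E)%E.
  rewrite -[X in _ --> X]adde0; apply: cvgeD; last exact: err_props.2.
    by rewrite fin_num_adde_defl.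
  exact: cvg_cst.
have f_ge0 n x : D x -> 0 <= f n x.
  by move=> Dx; rewrite addr_ge0// -lee_fin; [exact: f1_ge0|exact: f2_ge0].
have bound := fatou_bound mD mf f_ge0 fl fle al.
have mfl : measurable_fun D (fun x => Fu x * u x + delta x).
  exact: measurable_fun_cvg mf fl.
have mdelta : measurable_fun D delta.
  have -> : delta = (fun x => Fu x * u x + delta x - Fu x * u x).
    by apply/funext => x; rewrite addrAC subrr add0r.
  exact: measurable_funB mfl mFu.
have int0 : (\int[mu]_(x in D) `|(delta x)%:E| = 0)%E.
  have -> : (\int[mu]_(x in D) `|(delta x)%:E| = \int[mu]_(x in D) (delta x)%:E)%E.
    by apply: eq_integral => x /set_mem Dx; rewrite gee0_abs// lee_fin delta_ge0.
  apply/eqP; rewrite eq_le integral_ge0 ?andbT; last first.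
    by move=> x Dx; rewrite lee_fin delta_ge0.
  have fin : (\int[mu]_(x in D) (Fu x * u x)%:E)%E \is a fin_num.
    exact: integrable_fin_num.
  rewrite -(leeD2lE _ _ fin) adde0; apply: le_trans bound.
  have Fu0 x : D x -> (0 <= (Fu x * u x)%:E)%E.
    by move=> Dx; rewrite lee_fin; apply: mulr_ge0; [exact: (fe_ge0 feV)|exact/ltW/u_gt0].
  have d0 x : D x -> (0 <= (delta x)%:E)%E by move=> Dx; rewrite lee_fin delta_ge0.
  have mFuE : measurable_fun D (fun x => (Fu x * u x)%:E) by apply/measurable_EFinP.
  have mdE : measurable_fun D (fun x => (delta x)%:E) by apply/measurable_EFinP.
  by rewrite -(ge0_integralD mu mD Fu0 mFuE d0 mdE).
have mdE : measurable_fun D (EFin \o delta) by exact/measurable_EFinP.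
have := (ae_eq_integral_abs mu mD mdE).1 int0.
apply: filterS => x /= dx Dx; rewrite leNgt; apply/negP => vu.
by have := delta_gt0 Dx vu; have [->] := dx Dx; rewrite ltxx.
Qed.

End comparison.

(** For a function that is only measurable, both sides are the difference of the
integrals of the positive and negative parts. *)
Lemma integral_setD_null d (T : measurableType d) (R : realType)
    (mu : {measure set T -> \bar R}) (D E : set T) (f : T -> \bar R) :
  measurable D -> measurable E -> mu E = 0%E -> measurable_fun D f ->
  (\int[mu]_(x in D) f x = \int[mu]_(x in D `\` E) f x)%E.
Proof.
move=> mD mE E0 mf; rewrite integralE [RHS]integralE.
have mp := measurable_funepos mf; have mn := measurable_funeneg mf.
rewrite (ge0_negligible_integral mE mD mp _ E0); last first.
  by move=> x _; exact: funepos_ge0.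
by rewrite (ge0_negligible_integral mE mD mn _ E0).
Qed.

Section uniqueness.
Context {R : realType} {N : nat}.
Variables (Omega : set 'rV[R]_N) (H : 'rV[R]_N -> R) (p : R).
Hypotheses (oO : open Omega) (hH : admissible_anisotropy H) (p1 : 1 < p).
Variable F : 'rV[R]_N -> R -> R.
Hypothesis F_ge0 : forall x s, Omega x -> 0 < s -> 0 <= F x s.
Local Notation T := (lebesgueRV R N).
Local Notation mu := (@lebesgue_rV R N).

Let mO : measurable (Omega : set T). Proof. exact: open_measurable_rV. Qed.

Lemma weak_solution_off_null (u : 'rV[R]_N -> R) : weak_solution H p Omega F u ->
  exists (V : T -> 'rV[R]_N) (phi : nat -> 'rV[R]_N -> R) (g : T -> R) (E : set T),
  [/\ measurable E, mu E = 0%E &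
    forall E' : set T, measurable E' -> mu E' = 0%E -> E `<=` E' ->
    [/\ approximated Omega p (Omega `\` E') u V phi g,
        flux_equation Omega H p (Omega `\` E') V (fun x => F x (u x)) &
        forall x, (Omega `\` E') x -> 0 < u x]].
Proof.
move=> [V [W0 [E1 [mE1 E10 hE1]] L1 eqV]].
have [phi [g [E2 [mE2 E20 au]]]] := W1p0_approximated oO p1 W0.
have mV i : measurable_fun (Omega : set T) (fun x : T => V x 0 i).
  have [[_ LV _] _] := W0.
  by have [] := Lfun_p_integrable mO p1 (LV i).
have mF : measurable_fun (Omega : set T) (fun x : T => F x (u x)).
  apply: (measurable_fun_open oO) => K cK KO.
  by apply/measurable_EFinP; have /integrableP[] := L1 K cK KO.
exists V, phi, g, (E1 `|` E2); split.
- exact: measurableU.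
- by rewrite null_set_setU.
move=> E' mE' E'0 EE'.
have mD' : measurable (Omega `\` E' : set T) by exact: measurableD.
have u0 x : (Omega `\` E') x -> 0 < u x.
  move=> [Ox nE]; apply: contrapT => ux; apply: nE; apply: EE'; left.
  by apply: hE1 => /= /(_ Ox).
have au' : approximated Omega p (Omega `\` E') u V phi g.
  apply: (approximated_subset _ mD' _ au); first exact: measurableD.
  by move=> x [Ox nE]; split => // E2x; apply: nE; apply: EE'; right.
split; [exact: au'| |exact: u0]; split.
- exact: (ap_p_integrable_field p1 mD' au').
- by apply: measurable_funS mF => //; exact: subDsetl.
- by move=> x Dx; apply: F_ge0; [case: Dx|exact: u0].
- exact: L1.
- move=> f fC.
  have m1 : measurable_fun (Omega : set T)
      (fun x : T => (dot (finsler_flux H p (V x)) (grad f x))%:E).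
    apply/measurable_EFinP; apply: (measurable_fun_flux hH p1 mO mV) => i.
    have -> : (fun x : T => grad f x 0 i) = partial i f.
      by apply/funext => x; exact: grad_coord.
    apply: (continuous_measurable_rV mO); apply: Ck1_continuous_partial.
    exact: fC.1.
  have m2 : measurable_fun (Omega : set T) (fun x : T => (F x (u x) * f x)%:E).
    apply/measurable_EFinP; apply: (@measurable_funM _ T R Omega _ f mF).
    by apply: (continuous_measurable_rV mO); apply: Ck1_continuous; exact: fC.1.
  rewrite -(integral_setD_null mO mE' E'0 m1) -(integral_setD_null mO mE' E'0 m2).
  exact: eqV.
Qed.

End uniqueness.

Unset Implicit Arguments.

Theorem theorem1p1 (R : realType) (N : nat) (hN : (2 <= N)%N)
    (Omega : set 'rV[R]_N)
    (Omega_open : open Omega) (Omega_bounded : bounded_set Omega)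
    (Omega_smooth : smooth_boundary Omega)
    (H : 'rV[R]_N -> R) (hH : admissible_anisotropy H)
    (p : R) (p_gt1 : 1 < p) (p_ltN : p < N%:R)
    (F : 'rV[R]_N -> R -> R)
    (F_ge0 : forall x s, Omega x -> 0 < s -> 0 <= F x s)
    (F_caratheodory : caratheodory_fun Omega F)
    (F_decreasing : {ae lebesgue_rV, forall x : lebesgueRV R N, Omega x ->
       forall s t, 0 < s -> s < t ->
         F x t / t `^ (p - 1) < F x s / s `^ (p - 1)}) :
  forall u v : 'rV[R]_N -> R,
    weak_solution H p Omega F u -> weak_solution H p Omega F v ->
    {ae lebesgue_rV, forall x : lebesgueRV R N, Omega x -> u x = v x}.
Proof.
move=> u v su sv.
have [V [phi [g [Eu [mEu Eu0 hu]]]]] := weak_solution_off_null Omega_open hH p_gt1 F_ge0 su.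
have [W [psi [h [Ev [mEv Ev0 hv]]]]] := weak_solution_off_null Omega_open hH p_gt1 F_ge0 sv.
have [Ed [mEd Ed0 hd]] := F_decreasing.
pose E := Eu `|` Ev `|` Ed.
have mE : measurable E by apply: measurableU => //; exact: measurableU.
have E0 : lebesgue_rV E = 0%E by rewrite !null_set_setU//; exact: measurableU.
have [au eu u0] := hu E mE E0 (fun x Ex => or_introl (or_introl Ex)).
have [av ev v0] := hv E mE E0 (fun x Ex => or_introl (or_intror Ex)).
have mO : measurable (Omega : set (lebesgueRV R N)) by exact: open_measurable_rV.
have mD : measurable (Omega `\` E : set (lebesgueRV R N)) by exact: measurableD.
have decr x : (Omega `\` E) x -> forall s t, 0 < s -> s < t ->
    F x t / t `^ (p - 1) < F x s / s `^ (p - 1).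
  move=> [Ox nE]; apply: contrapT => ux; apply: nE; right.
  by apply: hd => /= /(_ Ox).
have uv := comparison hH p_gt1 mD au av u0 v0 eu ev
  (fun x Dx vu => decr x Dx _ _ (v0 x Dx) vu).
have vu := comparison hH p_gt1 mD av au v0 u0 ev eu
  (fun x Dx uv => decr x Dx _ _ (u0 x Dx) uv).
have nE : {ae lebesgue_rV, forall x : lebesgueRV R N, ~ E x}.
  by exists E; split => // x /= /contrapT.
move: uv vu nE; apply: filterS3 => x xuv xvu nEx Ox.
by apply/eqP; rewrite eq_le xuv ?xvu.
Qed.
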